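(* Let $n\ge2$ be an integer, $\alpha>0$ real, and let $X_1,\ldots,X_n$ be independent random variables, each with density $(\Gamma(\alpha))^{-1}e^{-x}x^{\alpha-1}$, $x>0$. Let $H_{\alpha,n}(r)=\Pr\{\sum_{i=1}^nX_i^2\le r^2\}$. Then for every $r>0$, $$H_{\alpha,n}(r)=r^{\alpha n}\sum_{k=0}^\infty\frac{\beta_{\alpha,n,k}}{\Gamma(1+(\alpha n+k)/2)}\,r^k=\frac{r^{\alpha n}}{\Gamma(\alpha n)}\sum_{k=0}^\infty\frac{\mu_{\alpha,n,k}}{\alpha n+k}\,\frac{(-r)^k}{k!},$$ where $$\beta_{\alpha,n,k}=(-1)^k(2\Gamma(\alpha))^{-n}\sum_{(k)}\prod_{i=1}^n\frac{\Gamma((\alpha+k_i)/2)}{k_i!},$$ and, for every integer $k\ge0$, $$\frac{(-1)^k}{k!}\,\mu_{\alpha,n,k}=2\,\Gamma(\alpha n)\,\frac{\beta_{\alpha,n,k}}{\Gamma((\alpha n+k)/2)}.$$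
   Context: The symbol $\sum_{(k)}$ denotes summation over all decompositions $k=k_1+\cdots+k_n$ with non-negative integers $k_1,\ldots,k_n$. $\Phi$ is the (random) angle between $(X_1,\ldots,X_n)$ and $(1,\ldots,1)$ in $\mathbb R^n$, i.e. $\sqrt n\cos\Phi=\big(\sum_iX_i\big)\big(\sum_iX_i^2\big)^{-1/2}$, and $\mu_{\alpha,n,k}=\mathbb E\big((\sqrt n\cos\Phi)^{\alpha n+k}\big)$ for integers $k\ge0$. *)

(* Defs.v *)
From HB Require Import structures.
From mathcomp Require Import all_boot all_order all_algebra.
From mathcomp Require Import all_classical all_reals all_analysis.
Set Implicit Arguments.
Unset Strict Implicit.
Unset Printing Implicit Defensive.
Import Order.TTheory GRing.Theory Num.Theory.
Import numFieldNormedType.Exports.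
Local Open Scope classical_set_scope.
Local Open Scope ring_scope.

(** Euler's Gamma function, meaningful for [0 < s]. *)
Definition Gamma (R : realType) (s : R) : R :=
  \int[lebesgue_measure]_(t in `]0, +oo[) (t `^ (s - 1) * expR (- t)).

Definition gamma_pdf (R : realType) (alpha : R) : R -> R :=
  (fun x => (Gamma alpha)^-1 * expR (- x) * x `^ (alpha - 1)) \_ `]0, +oo[.

Definition has_density (R : realType) d (T : measurableType d)
    (P : probability T R) (X : {RV P >-> R}) (f : R -> R) : Prop :=
  forall A : set R, measurable A ->
    distribution P X A = (\int[lebesgue_measure]_(x in A) (f x)%:E)%E.

(** Mutual independence: the product rule for every subfamily [J]. *)
Definition mutually_independent (R : realType) d (T : measurableType d)
    (P : probability T R) (I : finType) (X : I -> {RV P >-> R}) : Prop :=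
  forall (J : {set I}) (A : I -> set R), (forall i, measurable (A i)) ->
    P (\bigcap_(i in [set` J]) (X i @^-1` A i)) =
      (\prod_(i in J) P (X i @^-1` A i))%E.

Definition dot (R : realType) (n : nat) (u v : 'rV[R]_n) : R :=
  \sum_(i < n) u ord0 i * v ord0 i.

(** [`|u|] on row vectors is the sup norm, hence a separate Euclidean norm. *)
Definition enorm (R : realType) (n : nat) (u : 'rV[R]_n) : R :=
  Num.sqrt (dot u u).

(** Since [x / 0 = 0], the angle with the null vector is [pi / 2]. *)
Definition angle (R : realType) (n : nat) (u v : 'rV[R]_n) : R :=
  acos (dot u v / (enorm u * enorm v)).

Definition Phi (R : realType) d (T : measurableType d) (P : probability T R)
    (n : nat) (X : 'I_n -> {RV P >-> R}) (w : T) : R :=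
  angle (\row_i X i w) (const_mx 1).

(** The integrand is almost surely bounded ([0 <= sqrt n * cos Phi <= sqrt n]
    when the [X_i] are positive), so [fine] loses nothing. *)
Definition mu_moment (R : realType) d (T : measurableType d) (P : probability T R)
    (alpha : R) (n : nat) (X : 'I_n -> {RV P >-> R}) (k : nat) : R :=
  fine 'E_P[fun w => (Num.sqrt n%:R * cos (Phi X w))
                       `^ (alpha * n%:R + k%:R)].

(** The law [H_{alpha,n}], as a function of the variables [X_i]. *)
Definition radial_cdf (R : realType) d (T : measurableType d) (P : probability T R)
    (n : nat) (X : 'I_n -> {RV P >-> R}) (r : R) : \bar R :=
  P [set w | \sum_(i < n) X i w ^+ 2 <= r ^+ 2].

(** The parts [k_i] of a decomposition [k = k_1 + ... + k_n] are at most [k],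
    so decompositions are functions into ['I_k.+1]. *)
Definition beta_coef (R : realType) (alpha : R) (n k : nat) : R :=
  (-1) ^+ k * (2 * Gamma alpha) ^- n *
  \sum_(c : {ffun 'I_n -> 'I_k.+1} | (\sum_(i < n) c i)%N == k)
    \prod_(i < n) (Gamma ((alpha + (c i)%:R) / 2) / ((c i)`!)%:R).

(* Main.v *)
Require Import Defs.
From HB Require Import structures.
From mathcomp Require Import all_boot all_order all_algebra.
From mathcomp Require Import all_classical all_reals all_analysis.
From mathcomp Require Import measurable_realfun ring.
Set Implicit Arguments.
Unset Strict Implicit.
Unset Printing Implicit Defensive.
Import Order.TTheory GRing.Theory Num.Theory.
Import numFieldNormedType.Exports.
Local Open Scope classical_set_scope.
Local Open Scope ring_scope.

(** Write [S = sum X_i], [Q = sum X_i^2], [a = alpha n] and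
    [W = S / sqrt Q = sqrt n * cos Phi] (lemma [sqrt_cos_Phi]).

    Up to the factor [exp (- S)], the joint law of the sample is a measure
    homogeneous of degree [a] on the positive orthant. Homogeneity is used in
    the form of an exponential tilting identity: replacing the sample by [c X]
    amounts to weighting it by [c^(- a) exp ((1 - 1 / c) S)]
    ([integral_tilt_tuple], read on the pair [(S, Q)] in
    [integral_tilt_sum_sumsq]). Inserting
    [Gamma a = S^a int_0^oo u^(a - 1) exp (- u S) du], exchanging the
    integrals and tilting by [c = 1 / u] separates scale from direction
    without spherical coordinates ([polar_decomposition]):

      [Gamma a E g(S, Q) =
         E int_0^oo u^-1 (S / u)^a exp (- S / u) g(S / u, Q / u^2) du].

    Two choices of [g] give the theorem.

    - For [g(s, q) = s^k exp (s - q)] the inner integral is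
      [W^(a + k) Gamma ((a + k) / 2) / 2], while the left-hand side factors
      over the coordinates after a multinomial expansion of [S^k] and equals
      [Gamma a k! (-1)^k beta_k] ([integral_sum_gauss]). This is the
      identity between [mu_k] and [beta_k] ([integral_rv_ratio_powR]).

    - For [g(s, q) = 1_(q <= r^2)] the left-hand side is [Gamma a H(r)], and
      the inner integral is an incomplete gamma function of [r W], whose power
      series ([incomplete_gamma_series]) may be integrated term by term
      because [W <= sqrt n] ([radial_cdf_power_series]). This is the
      [mu]-series; the [beta]-series is the same series, term by term, by the
      first identity and [Gamma (1 + z) = z Gamma z]. *)

(** * Comparison and substitution of nonnegative integrals *)

Lemma measurable_set_ltr (R : realType) d (T : measurableType d) (f g : T -> R) :
  measurable_fun setT f -> measurable_fun setT g ->
  measurable [set x | f x < g x].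
Proof.
move=> mf mg; rewrite -[X in measurable X]setTI.
by apply: (measurable_fun_ltr mf mg) => //; exact: (I : measurable [set true]).
Qed.

(** Layer-cake principle: [F (V x)] is the length of [{t | 0 < t < F (V x)}], so
    by Tonelli an integral against [F] is a mixture over [t] of integrals
    against the indicators of [{s | t < F s}]. An identity between weighted
    integrals thus extends from indicators to nonnegative functions; it serves
    for image laws, densities, scalings and independence alike. *)
Lemma transfer_ge0_integral (R : realType) d1 d2 d
    (T1 : measurableType d1) (T2 : measurableType d2) (S : measurableType d)
    (m1 : {sigma_finite_measure set T1 -> \bar R})
    (m2 : {sigma_finite_measure set T2 -> \bar R})
    (V1 : T1 -> S) (V2 : T2 -> S) (h1 : T1 -> R) (h2 : T2 -> R) :
  measurable_fun setT V1 -> measurable_fun setT V2 ->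
  measurable_fun setT h1 -> measurable_fun setT h2 ->
  (forall x, 0 <= h1 x) -> (forall x, 0 <= h2 x) ->
  (forall A, measurable A -> \int[m1]_x (\1_A (V1 x) * h1 x)%:E =
                             \int[m2]_x (\1_A (V2 x) * h2 x)%:E)%E ->
  forall F : S -> R, measurable_fun setT F -> (forall s, 0 <= F s) ->
  (\int[m1]_x (F (V1 x) * h1 x)%:E = \int[m2]_x (F (V2 x) * h2 x)%:E)%E.
Proof.
move=> mV1 mV2 mh1 mh2 h10 h20 H F mF F0.
have layer d' (T : measurableType d') (m : {sigma_finite_measure set T -> \bar R})
    (V : T -> S) (h : T -> R) : measurable_fun setT V -> measurable_fun setT h ->
    (forall x, 0 <= h x) ->
  (\int[m]_x (F (V x) * h x)%:E = \int[lebesgue_measure]_t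
    \int[m]_x (\1_(if (0 < t)%R then [set s | (t < F s)%R] else set0) (V x) * h x)%:E)%E.
  move=> mV mh h0.
  (* [D] is the region below the graph of [F \o V] *)
  pose D := [set z : T * R | 0 < z.2] `&` [set z : T * R | z.2 < F (V z.1)].
  have mD : measurable D.
    by apply: measurableI; apply: measurable_set_ltr => //;
      apply: measurableT_comp => //; exact: measurableT_comp.
  pose f (z : T * R) := (\1_D z * h z.1)%:E.
  have mf : measurable_fun setT f.
    apply/measurable_EFinP; apply: measurable_funM => //.
    by apply: measurableT_comp.
  have f0 z : (0 <= f z)%E by rewrite lee_fin mulr_ge0.
  transitivity (\int[m]_x \int[lebesgue_measure]_t f (x, t))%E.
    apply: eq_integral => x _.
    transitivity (\int[lebesgue_measure]_t ((h x)%:E * (\1_(`]0, F (V x)[%classic) t)%:E))%E.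
      rewrite ge0_integralZl ?lee_fin//.
      rewrite integral_indic//= setIT lebesgue_measure_itv/= lte_fin.
      by have := F0 (V x); rewrite le_eqVlt => /predU1P[<-|->];
        rewrite ?ltxx ?mul0r ?mule0// oppr0 adde0 -EFinM mulrC.
      by apply/measurable_EFinP.
    apply: eq_integral => t _; rewrite /f -EFinM mulrC; congr ((_ * _)%:E).
    rewrite !indicE; congr (_%:R); congr nat_of_bool; apply/idP/idP; rewrite !inE /D/= in_itv/=.
      by move=> /andP.
    by move=> [-> ->].
  transitivity (\int[lebesgue_measure]_t \int[m]_x f (x, t))%E.
    by rewrite fubini_tonelli.
  apply: eq_integral => t _; apply: eq_integral => x _; rewrite /f; congr ((_ * _)%:E).
  rewrite !indicE; congr (_%:R); congr nat_of_bool.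
  case: ifPn => t0; apply/idP/idP; rewrite !inE /D//=; first by case.
  by move=> [t0' _]; rewrite t0' in t0.
rewrite !layer//; apply: eq_integral => t _; apply: H.
by case: ifP => // _; exact: measurable_set_ltr.
Qed.

Lemma measurable_scale (R : realType) (c : R) : measurable_fun setT ( *%R c : R -> R).
Proof. exact: measurable_funM. Qed.

(** Both sides are measures, and they agree on intervals. *)
Lemma lebesgue_measure_scale (R : realType) (c : R) (A : set R) : c != 0 ->
  measurable A ->
  (lebesgue_measure A = `|c|%:E * lebesgue_measure ( *%R c @^-1` A))%E.
Proof.
move=> c0 mA.
pose phi : R -> measurableTypeR R := *%R c.
have c_ge0 : 0 <= `|c| by [].
have mphi : measurable_fun [set: measurableTypeR R] phi by exact: measurable_scale.
have /(_ mphi) := @lebesgue_measure_unique _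
  (mscale (NngNum c_ge0) (pushforward (@lebesgue_measure R) phi)).
apply => // _ [[a b]] _ <-.
rewrite -[RHS]/(`|c|%:E * lebesgue_measure (phi @^-1` `]a, b]))%E.
have [c_gt0|c_lt0|] := ltgtP 0 c; last by move=> ce; rewrite -ce eqxx in c0.
- have -> : phi @^-1` `]a, b] = `]a / c, b / c]%classic.
    by apply/seteqP; split => x; rewrite /phi/= !in_itv/= ltr_pdivrMr// ler_pdivlMr// ![_ * c]mulrC.
  rewrite !lebesgue_measure_itv/= !lte_fin ltr_pM2r ?invr_gt0//.
  case: ifPn => _; last by rewrite mule0.
  by rewrite -!EFinB -EFinM gtr0_norm//; congr EFin; field.
- have -> : phi @^-1` `]a, b] = `[b / c, a / c[%classic.
    by apply/seteqP; split => x;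
      rewrite /phi/= !in_itv/= ltr_ndivlMr// ler_ndivrMr// ![_ * c]mulrC andbC.
  rewrite !lebesgue_measure_itv/= !lte_fin ltr_nM2r ?invr_lt0//.
  case: ifPn => _; last by rewrite mule0.
  by rewrite -!EFinB -EFinM ltr0_norm//; congr EFin; field.
Qed.

Lemma ge0_integral_scale (R : realType) (c : R) (F : R -> R) : c != 0 ->
  measurable_fun setT F -> (forall x, 0 <= F x) ->
  (\int[lebesgue_measure]_x (F x)%:E =
   `|c|%:E * \int[lebesgue_measure]_x (F (c * x)%R)%:E)%E.
Proof.
move=> c0 mF F0.
transitivity (\int[lebesgue_measure]_x (F (idfun x) * cst 1 x)%:E)%E.
  by apply: eq_integral => x _; rewrite /= mulr1.
rewrite (@transfer_ge0_integral _ _ _ _ _ _ _ lebesgue_measure lebesgue_measure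
  idfun ( *%R c) (cst 1) (cst `|c|))//; last 2 first.
- exact: measurable_id.
- move=> A mA; under eq_integral do rewrite /= mulr1.
  under [RHS]eq_integral do rewrite /= mulrC EFinM.
  rewrite ge0_integralZl ?lee_fin//; last first.
    by apply/measurable_EFinP; apply: measurableT_comp => //; exact: measurable_scale.
  rewrite integral_indic//= setIT (lebesgue_measure_scale c0)//; congr (_ * _)%E.
  have -> : (fun x => (\1_A (c * x))%:E) = (fun x => (\1_( *%R c @^-1` A) x)%:E :> \bar R).
    by apply/funext => x; rewrite !indicE; congr (_%:R%:E); congr nat_of_bool;
      apply/idP/idP; rewrite !inE.
  rewrite integral_indic ?setIT//.
  by rewrite -[X in measurable X]setTI; exact: (measurable_scale c measurableT).

under eq_integral do rewrite /= mulrC EFinM.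
rewrite ge0_integralZl ?lee_fin//; last by move=> x _; rewrite lee_fin.
by apply/measurable_EFinP; apply: measurableT_comp => //; exact: measurable_scale.
Qed.

(** The intervals from [- n] to [n] and their images under [exp] exhaust the
    two domains, and on each of them the substitution is the classical one. *)
Lemma ge0_integral_exp_subst (R : realType) (f : R -> R) :
  {in `]0, +oo[, continuous f} -> {in `]0, +oo[, forall x, 0 <= f x} ->
  (\int[lebesgue_measure]_(x in `]0%R, +oo[) (f x)%:E =
   \int[lebesgue_measure]_s (f (expR s) * expR s)%:E)%E.
Proof.
move=> cf f0.
pose A (n : nat) := `[expR (- n%:R), expR n%:R]%classic : set R.
pose B (n : nat) := `[(- n%:R), n%:R]%classic : set R.
have mf : @measurable_fun _ _ R R `]0%R, +oo[ f.
  by apply: open_continuous_measurable_fun => // x; rewrite inE => /cf.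
have mfe : measurable_fun setT (fun s => f (expR s) * expR s).
  apply: measurable_funM => //.
  apply: (measurable_comp (F := (`]0%R, +oo[%classic : set R))) mf _ => //.
  by move=> _ [s _ <-] /=; rewrite in_itv/= andbT expR_gt0.
have Apos n x : A n x -> x \in `]0, +oo[.
  rewrite /A/= !in_itv/= andbT => /andP[+ _]; apply: lt_le_trans; exact: expR_gt0.
have AU : \bigcup_n A n = `]0, +oo[%classic.
  apply/seteqP; split => [x [n _]|x]; first exact: Apos.
  rewrite /= in_itv/= andbT => x0; exists (Num.truncn `|ln x|).+1 => //.
  rewrite /A/= in_itv/= -{2 3}(lnK x0) !ler_expR -ler_norml ltW//.
  exact: truncnS_gt.
have BU : \bigcup_n B n = setT.
  apply/seteqP; split => // x _; exists (Num.truncn `|x|).+1 => //.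
  by rewrite /B/= in_itv/= -ler_norml ltW// truncnS_gt.
have cA : (\int[lebesgue_measure]_(x in A n) (f x)%:E @[n --> \oo] -->
    \int[lebesgue_measure]_(x in `]0%R, +oo[) (f x)%:E)%E.
  rewrite -AU; apply: ge0_nondecreasing_set_cvg_integral.
  - move=> m n mn; rewrite subsetEset => x; rewrite /A/= !in_itv/= => /andP[x1 x2].
    rewrite (le_trans _ x1) ?(le_trans x2)// ler_expR ?lerN2 ler_nat//.
  - by move=> n; exact: measurable_itv.
  - move=> n; apply/measurable_EFinP; apply: measurable_funS mf => //.
    by move=> x /Apos.
  - by move=> n x /Apos x0; rewrite lee_fin f0.
have cB : (\int[lebesgue_measure]_(x in B n) (f (expR x) * expR x)%:E @[n --> \oo] -->
    \int[lebesgue_measure]_x (f (expR x) * expR x)%:E)%E.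
  rewrite -BU; apply: ge0_nondecreasing_set_cvg_integral.
  - move=> m n mn; rewrite subsetEset => x; rewrite /B/= !in_itv/= => /andP[x1 x2].
    rewrite (le_trans _ x1) ?(le_trans x2)// ?lerN2 ler_nat//.
  - by move=> n; exact: measurable_itv.
  - by move=> n; apply/measurable_EFinP; apply: measurable_funS mfe.
  - by move=> n x _; rewrite lee_fin mulr_ge0 ?expR_ge0// f0// in_itv/= expR_gt0.
have dE : derive1 (@expR R) = expR by apply/funext => x; rewrite derive1E derive_val.
apply: (cvg_unique _ cA) => //; apply: cvg_trans cB.
apply: near_eq_cvg; near=> n.
rewrite /A /B integration_by_substitution_increasing//.
- by apply: eq_integral => x _; rewrite dE.
- by rewrite (le_trans (y:= 0))// oppr_le0.
- by move=> x y _ _; rewrite ltr_expR.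
- by rewrite dE => x _; exact: continuous_expR.
- by rewrite dE; apply: cvgP; apply: cvg_at_right_filter; exact: continuous_expR.
- by rewrite dE; apply: cvgP; apply: cvg_at_left_filter; exact: continuous_expR.
- split => //.
  + by apply: cvg_at_right_filter; exact: continuous_expR.
  + by apply: cvg_at_left_filter; exact: continuous_expR.
- apply: continuous_in_subspaceT => x; rewrite inE => /Apos; exact: cf.
Unshelve. all: by end_near. Qed.

Lemma powR_expR (R : realType) (s q : R) : expR s `^ q = expR (q * s).
Proof. by rewrite mulrC expRM. Qed.

Lemma continuous_powR (R : realType) (q : R) :
  {in `]0, +oo[, continuous (fun x => x `^ q)}.
Proof.
move=> x; rewrite in_itv/= andbT => x0.
apply/differentiable_continuous/derivable1_diffP.
by apply: derivable_powR; rewrite in_itv/= andbT.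
Qed.

(** In the variable [s = ln x] the substitution [x := x ^ q] is the scaling
    [s := q s], which treats both signs of [q] at once. *)
Lemma ge0_integral_powR_subst (R : realType) (q : R) (f : R -> R) : q != 0 ->
  {in `]0, +oo[, continuous f} -> {in `]0, +oo[, forall x, 0 <= f x} ->
  (\int[lebesgue_measure]_(x in `]0%R, +oo[) (f x)%:E =
   `|q|%:E * \int[lebesgue_measure]_(x in `]0%R, +oo[)
     (f (x `^ q) * x `^ (q - 1))%:E)%E.
Proof.
move=> q0 cf f0.
have gt0E (x : R) : (x \in `]0, +oo[) = (0 < x) by rewrite in_itv/= andbT.
rewrite !ge0_integral_exp_subst//; last 2 first.
- move=> x x0; apply: cvgM; last exact: continuous_powR.
  apply: continuous_comp; first exact: continuous_powR.
  by apply: cf; rewrite gt0E powR_gt0// -gt0E.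
- by move=> x x0; rewrite mulr_ge0 ?powR_ge0// f0// gt0E powR_gt0// -gt0E.
rewrite (@ge0_integral_scale _ q (fun s => f (expR s) * expR s))//; last 2 first.
- have mf : @measurable_fun _ _ R R `]0%R, +oo[ f.
    by apply: open_continuous_measurable_fun => // x; rewrite inE => /cf.
  apply: measurable_funM => //.
  apply: (measurable_comp (F := (`]0%R, +oo[%classic : set R))) mf _ => //.
  by move=> _ [s _ <-] /=; rewrite gt0E expR_gt0.
- by move=> x; rewrite mulr_ge0 ?expR_ge0// f0// gt0E expR_gt0.
congr (_ * _)%E; apply: eq_integral => s _; congr EFin.
rewrite !powR_expR -mulrA -expRD; congr (_ * expR _); ring.
Qed.

(** * The Gamma function *)

Lemma integral_expRN_itvoy (R : realType) (x : R) :
  (\int[lebesgue_measure]_(t in `]x, +oo[) (expR (- t))%:E = (expR (- x))%:E)%E.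
Proof.
rewrite integral_itv_obnd_cbnd; last first.
  apply/measurable_EFinP; apply: measurableT_comp => //.
have dF (t : R) : is_derive t 1 (fun t => - expR (- t)) (expR (- t)).
  by apply: is_derive_eq; rewrite mulrN1 opprK.
rewrite (@ge0_continuous_FTC2y _ (fun t => expR (- t)) (fun t => - expR (- t)) x 0).
- by rewrite sub0e -EFinN opprK.
- by move=> t _; exact: expR_ge0.
- apply: continuous_subspaceT => t.
  by apply: continuous_comp; [exact: opp_continuous|exact: continuous_expR].
- rewrite -oppr0; apply: cvgN.
  exact: cvgr_expR.
- by move=> t _; exact: (@ex_derive _ _ _ _ _ _ _ (dF t)).
- apply: cvg_at_right_filter; apply: cvgN.
  by apply: continuous_comp; [exact: opp_continuous|exact: continuous_expR].
- by move=> t _; rewrite derive1E derive_val.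
Qed.

Lemma integral_mkindic (R : realType) d (T : measurableType d)
    (m : {measure set T -> \bar R}) (D : set T) (f : T -> R) :
  (\int[m]_(x in D) (f x)%:E = \int[m]_x (\1_D x * f x)%:E)%E.
Proof.
rewrite integral_mkcond; apply: eq_integral => x _.
by rewrite patchE indicE; case: ifPn => _; rewrite ?mul1r ?mul0r.
Qed.

Lemma indic_itv0y (R : realType) (x : R) : \1_(`]0, +oo[%classic : set R) x = (0 < x)%R%:R :> R.
Proof. by rewrite indicE mem_setE in_itv/= andbT. Qed.

Definition gamma_kernel (R : realType) (p t : R) : R := t `^ (p - 1) * expR (- t).

Lemma gamma_kernel_ge0 (R : realType) (p t : R) : 0 <= gamma_kernel p t.
Proof. by rewrite mulr_ge0 ?powR_ge0 ?expR_ge0. Qed.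

Lemma continuous_gamma_kernel (R : realType) (p : R) :
  {in `]0, +oo[, continuous (gamma_kernel p)}.
Proof.
move=> t t0; apply: cvgM; first exact: continuous_powR.
by apply: continuous_comp; [exact: opp_continuous|exact: continuous_expR].
Qed.

Lemma measurable_gamma_kernel (R : realType) (p : R) (D : set R) :
  measurable_fun D (gamma_kernel p).
Proof.
apply: measurable_funM; first exact: measurable_funTS (measurable_powR _).
by apply: measurable_funTS; apply: measurableT_comp.
Qed.

(** The substitution [t = y^(1/p)] removes the possible singularity at
    the origin. *)
Lemma integral_gamma_kernel_powR (R : realType) (p : R) : 0 < p ->
  (p%:E * \int[lebesgue_measure]_(t in `]0%R, +oo[) (gamma_kernel p t)%:E =
   \int[lebesgue_measure]_(y in `]0%R, +oo[) (expR (- (y `^ p^-1)))%:E)%E.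
Proof.
move=> p0; have pV0 : p^-1 != 0 by rewrite invr_eq0 gt_eqF.
rewrite (ge0_integral_powR_subst pV0); last 2 first.
- exact: continuous_gamma_kernel.
- by move=> t _; exact: gamma_kernel_ge0.
rewrite muleA -EFinM ger0_norm ?invr_ge0 ?(ltW p0)// divff ?gt_eqF// mul1e.
apply: eq_integral => y; rewrite inE/= in_itv/= andbT => y0; congr EFin.
rewrite /gamma_kernel -powRrM mulrAC -powRD; last by rewrite (gt_eqF y0) implybT.
rewrite (_ : _ + _ = 0) ?powRr0 ?mul1r//.
by field; rewrite (lt0r_neq0 p0).
Qed.

(** Tonelli on the region [y^(1/p) < t]: integrating [exp (- t)] first in [t]
    gives the previous form of [p Gamma p], and first in [y], over an interval
    of length [t^p], gives [Gamma (p + 1)]. The identity holds in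
    the extended reals, so finiteness can be deduced from it. *)
Lemma integral_gamma_kernelS (R : realType) (p : R) : 0 < p ->
  (\int[lebesgue_measure]_(t in `]0%R, +oo[) (gamma_kernel (p + 1) t)%:E =
   p%:E * \int[lebesgue_measure]_(t in `]0%R, +oo[) (gamma_kernel p t)%:E)%E.
Proof.
move=> p0; rewrite integral_gamma_kernel_powR//.
pose D := [set z : R * R | 0 < z.1] `&` [set z : R * R | z.1 `^ p^-1 < z.2].
have mD : measurable D.
  apply: measurableI; apply: measurable_set_ltr => //.
  by apply: (measurableT_comp (measurable_powR _)).
pose f (z : R * R) := (\1_D z * expR (- z.2))%:E.
have mf : measurable_fun setT f.
  apply/measurable_EFinP; apply: measurable_funM => //.
  by apply: measurableT_comp => //; apply: measurableT_comp.
have f0 z : (0 <= f z)%E by rewrite lee_fin mulr_ge0 ?expR_ge0.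
transitivity (\int[lebesgue_measure]_t \int[lebesgue_measure]_y f (y, t))%E.
  (* the section of [D] at height [t > 0] is the interval ]0, t^p[ *)
  rewrite integral_mkindic; apply: eq_integral => t _.
  have DE y : \1_D (y, t) = \1_(if 0 < t then `]0, t `^ p[%classic else set0) y :> R.
    rewrite !indicE; congr (_%:R); congr nat_of_bool; apply/idP/idP; rewrite !inE /D/=.
      move=> [/= y0]; case: (ltP 0 t) => t0; last first.
        by move=> /lt_le_trans /(_ t0); rewrite ltNge powR_ge0.
      rewrite /= in_itv/= y0/= => /(gt0_ltr_powR p0).
      rewrite !nnegrE powR_ge0 ltW// -powRrM mulVf ?gt_eqF// powRr1 ?ltW//.
      exact.
    case: ifPn => t0 //=; rewrite in_itv/= => /andP[y0 yt]; split => //.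
    have pV0 : 0 < p^-1 by rewrite invr_gt0.
    have := @gt0_ltr_powR _ _ pV0 _ _ _ _ yt.
    by rewrite !nnegrE powR_ge0 (ltW y0) -powRrM mulfV ?gt_eqF// powRr1 ?ltW//; exact.
  under [RHS]eq_integral do rewrite /f DE/= mulrC EFinM.
  rewrite ge0_integralZl ?lee_fin ?expR_ge0//; last first.
    by apply/measurable_EFinP; apply: measurable_indic; case: ifP.
  rewrite integral_indic//=; last by case: ifP.
  rewrite setIT indic_itv0y.
  case: ifPn => t0; last by rewrite measure0 mule0 mul0r.
  rewrite mul1r lebesgue_measure_itv/= lte_fin powR_gt0// oppr0 adde0.
  by rewrite -EFinM /gamma_kernel addrK mulrC.
transitivity (\int[lebesgue_measure]_y \int[lebesgue_measure]_t f (y, t))%E.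
  by rewrite fubini_tonelli.
rewrite [RHS]integral_mkindic; apply: eq_integral => y _.
rewrite indic_itv0y; case: (ltP 0 y) => y0; last first.
  by rewrite mul0r integral0_eq// => t _;
    rewrite /f indicE memNset ?mul0r// => -[/=]; rewrite ltNge y0.
rewrite mul1r -integral_expRN_itvoy [RHS]integral_mkindic; apply: eq_integral => t _.
rewrite /f/=; congr ((_ * _)%:E).
by rewrite !indicE; congr (_%:R); congr nat_of_bool;
  apply/idP/idP; rewrite !inE /D/= in_itv/= andbT; [case|].
Qed.

Lemma integral_gamma_kernel_nat_lty (R : realType) (n : nat) :
  (\int[lebesgue_measure]_(t in `]0%R, +oo[) (gamma_kernel (n.+1%:R : R) t)%:E < +oo)%E.
Proof.
elim: n => [|n IHn].
  rewrite (_ : \int[lebesgue_measure]_(t in _) _ =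
      \int[lebesgue_measure]_(t in `]0%R, +oo[) (expR (- t))%:E)%E.
    by rewrite integral_expRN_itvoy ltry.
  by apply: eq_integral => t _; rewrite /gamma_kernel subrr powRr0 mul1r.
by rewrite -[in X in (X < _)%E]natr1 integral_gamma_kernelS ?ltr0n// lte_mul_pinfty// lee_fin.
Qed.

(** By the recursion it suffices to bound the integral at [p + 1], and there
    [t^p <= 1 + t^m] for an integer [m >= p]. *)
Lemma Gamma_integralE (R : realType) (p : R) : 0 < p ->
  (\int[lebesgue_measure]_(t in `]0%R, +oo[) (gamma_kernel p t)%:E = (Gamma p)%:E)%E.
Proof.
move=> p0; rewrite /Gamma /Rintegral fineK//.
have ge0_I q : (0 <= \int[lebesgue_measure]_(t in `]0%R, +oo[) (gamma_kernel (q : R) t)%:E)%E.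
  by apply: integral_ge0 => t _; rewrite lee_fin gamma_kernel_ge0.
rewrite ge0_fin_numE ?ge0_I//.
pose I := (\int[lebesgue_measure]_(t in `]0%R, +oo[) (gamma_kernel p t)%:E)%E.
rewrite -/I; have := ge0_I p; rewrite -/I => I0.
suff : (\int[lebesgue_measure]_(t in `]0%R, +oo[) (gamma_kernel (p + 1) t)%:E < +oo)%E.
  rewrite integral_gamma_kernelS// -/I.
  move: I I0 => [r _ _|_|//]; first exact: ltry.
  by rewrite mulry gtr0_sg// mul1e ltxx.
have [m pm] : exists m : nat, p <= m%:R.
  by exists (Num.truncn p).+1; rewrite ltW// truncnS_gt.
apply: (@le_lt_trans _ _ (\int[lebesgue_measure]_(t in `]0%R, +oo[)
   ((gamma_kernel 1 t)%:E + (gamma_kernel m.+1%:R t)%:E))%E).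
  apply: ge0_le_integral => //.
  - by move=> t _; rewrite lee_fin gamma_kernel_ge0.
  - by apply/measurable_EFinP; exact: measurable_gamma_kernel.
  - by apply: emeasurable_funD; apply/measurable_EFinP; exact: measurable_gamma_kernel.
  - move=> t; rewrite /= in_itv/= andbT => t0; rewrite -EFinD lee_fin /gamma_kernel.
    rewrite -mulrDl ler_wpM2r ?expR_ge0// subrr powRr0 addrK -natr1 addrK.
    have [t1|t1] := leP t 1.
      rewrite (@le_trans _ _ 1)// ?lerDl ?powR_ge0//.
      by rewrite -(powRr0 t) ger_powR ?t0// ltW.
    by rewrite (@le_trans _ _ (t `^ m%:R))// ?ler_powR// ?lerDr// ltW.
rewrite ge0_integralD//.
- apply: lte_add_pinfty; last exact: integral_gamma_kernel_nat_lty.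
  by rewrite -[1%R]/(1%:R); exact: integral_gamma_kernel_nat_lty.
- by move=> t _; rewrite lee_fin gamma_kernel_ge0.
- by apply/measurable_EFinP; exact: measurable_gamma_kernel.
- by move=> t _; rewrite lee_fin gamma_kernel_ge0.
- by apply/measurable_EFinP; exact: measurable_gamma_kernel.
Qed.

Lemma GammaS (R : realType) (p : R) : 0 < p -> Gamma (p + 1) = p * Gamma p.
Proof.
move=> p0; apply: EFin_inj; rewrite EFinM -!Gamma_integralE ?addr_gt0//.
exact: integral_gamma_kernelS.
Qed.

Lemma Gamma_gt0 (R : realType) (p : R) : 0 < p -> 0 < Gamma p.
Proof.
move=> p0; rewrite -(pmulr_rgt0 _ p0) -lte_fin EFinM -Gamma_integralE//.
rewrite integral_gamma_kernel_powR//.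
have mf : measurable_fun setT (fun y : R => (expR (- (y `^ p^-1)))%:E).
  apply/measurable_EFinP; apply: measurableT_comp => //.
  by apply: measurableT_comp => //; exact: measurable_powR.
apply: (@lt_le_trans _ _ (\int[lebesgue_measure]_(y in `]0%R, 1%R[) (expR (- 1))%:E)%E).
  rewrite integral_cst//= lebesgue_measure_itv/= lte_fin ltr01 oppr0 adde0 mule1.
  by rewrite lte_fin expR_gt0.
apply: (@le_trans _ _ (\int[lebesgue_measure]_(y in `]0%R, 1%R[) (expR (- (y `^ p^-1)))%:E)%E).
  apply: ge0_le_integral => //.
  - exact: measurable_funTS.
  - move=> y; rewrite /= in_itv/= => /andP[y0 y1].
    rewrite lee_fin ler_expR lerN2 -(powRr0 y) ger_powR ?y0 ?ltW//.
    by rewrite invr_gt0.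
apply: ge0_subset_integral => //.
- exact: measurable_funTS.
- by apply: subset_itvl.
Qed.

(** The substitution [x := x ^ q] in the Gamma integral. The case [q = 1] gives
    [S^(- a) Gamma a], the case [q = 2] the Gaussian moments of a coordinate,
    and the case [q = - 2] the integral over the scale variable. *)
Lemma integral_power_gamma (R : realType) (p q c : R) : 0 < p -> q != 0 -> 0 < c ->
  (\int[lebesgue_measure]_(u in `]0%R, +oo[) (u `^ (p * q - 1) * expR (- (c * u `^ q)))%:E
   = (c `^ (- p) * Gamma p / `|q|)%:E)%E.
Proof.
move=> p0 q0 c0.
have q0' : `|q| != 0 by rewrite normr_eq0.
pose f (v : R) := v `^ (p - 1) * expR (- (c * v)).
have f0 v : 0 <= f v by rewrite mulr_ge0 ?powR_ge0 ?expR_ge0.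
have mf : measurable_fun setT f.
  apply: measurable_funM; first exact: measurable_powR.
  apply: measurableT_comp => //; apply: measurableT_comp => //.
(* the scaling [v := c v] settles the case [q = 1] *)
have If : (\int[lebesgue_measure]_(v in `]0%R, +oo[) (f v)%:E = (c `^ (- p) * Gamma p)%:E)%E.
  rewrite EFinM -Gamma_integralE// integral_mkindic [in RHS]integral_mkindic.
  rewrite [in RHS](@ge0_integral_scale _ c
    (fun x => \1_(`]0, +oo[%classic : set R) x * gamma_kernel p x)) ?gt_eqF//; last 2 first.
  - by apply: measurable_funM => //; exact: measurable_gamma_kernel.
  - by move=> x; rewrite mulr_ge0 ?gamma_kernel_ge0.
  rewrite muleA -EFinM -ge0_integralZl ?lee_fin ?mulr_ge0 ?powR_ge0//; last 2 first.
  - apply/measurable_EFinP; apply: measurable_funM.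
      by apply: measurableT_comp => //; exact: measurable_scale.
    apply: measurableT_comp; first exact: measurable_gamma_kernel.
    exact: measurable_scale.
  - by move=> x _; rewrite lee_fin mulr_ge0 ?gamma_kernel_ge0.
  apply: eq_integral => x _; rewrite -EFinM; congr EFin.
  rewrite !indic_itv0y pmulr_rgt0//.
  have [x0|x0] := ltP 0 x; last by rewrite !mul0r mulr0.
  have E : c `^ (- p) * (c * c `^ (p - 1)) = 1.
    rewrite mulr_powRB1 ?ltW// -powRD ?(gt_eqF c0) ?implybT//.
    by rewrite addNr powRr0.
  rewrite !mul1r /f /gamma_kernel powRM ?(ltW c0) ?(ltW x0)// gtr0_norm//.
  by rewrite -[LHS]mul1r -[X in X * _ = _]E; ring.
have -> : ((c `^ (- p) * Gamma p / `|q|)%:E =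
    (`|q|^-1)%:E * \int[lebesgue_measure]_(v in `]0%R, +oo[) (f v)%:E)%E.
  by rewrite If -EFinM mulrC.
rewrite [X in (_ = _ * X)%E](ge0_integral_powR_subst q0)//; last first.
  move=> v v0; apply: cvgM; first exact: continuous_powR.
  apply: continuous_comp; last exact: continuous_expR.
  by apply: cvgN; apply: cvgM => //; exact: cvg_cst.
rewrite muleA -EFinM mulVf// mul1e; apply: eq_integral => u.
rewrite inE/= in_itv/= andbT => u0; congr EFin.
rewrite /f mulrAC -powRrM -powRD; last by rewrite (gt_eqF u0) implybT.
by congr (_ `^ _ * _); ring.
Qed.

(** * Expectations of products of independent variables *)

Lemma measurable_preimageT d1 d2 (T1 : measurableType d1) (T2 : measurableType d2)
    (V : T1 -> T2) (A : set T2) :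
  measurable_fun setT V -> measurable A -> measurable (V @^-1` A).
Proof. by move=> mV mA; rewrite -[X in measurable X]setTI; exact: mV. Qed.

Lemma integral_indic_comp (R : realType) d1 d2 (T1 : measurableType d1)
    (T2 : measurableType d2) (m : {measure set T1 -> \bar R}) (V : T1 -> T2)
    (A : set T2) : measurable_fun setT V -> measurable A ->
  (\int[m]_x (\1_A (V x))%:E = m (V @^-1` A))%E.
Proof.
move=> mV mA; have mVA := measurable_preimageT mV mA.
have -> : (fun x => (\1_A (V x))%:E) = (fun x => (\1_(V @^-1` A) x)%:E) :> (_ -> \bar R).
  by apply/funext => x; rewrite !indicE; congr (_%:R%:E); congr nat_of_bool;
    apply/idP/idP; rewrite !inE.
by rewrite integral_indic// setIT.
Qed.

(** Independence is the case of indicators. Starting from it, the factors are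
    replaced by arbitrary functions one coordinate at a time; [J] is the set
    of coordinates already replaced. *)
Lemma integral_prod_independent (R : realType) d (T : measurableType d)
    (P : probability T R) (I : finType) (X : I -> {RV P >-> R})
    (g : I -> R -> R) (e : I -> R) : mutually_independent X ->
  (forall i, measurable_fun setT (g i)) -> (forall i x, 0 <= g i x) ->
  (forall i, \int[P]_w (g i (X i w))%:E = (e i)%:E)%E ->
  (\int[P]_w (\prod_i g i (X i w))%:E = (\prod_i e i)%:E)%E.
Proof.
move=> indX mg g0 ge.
suff H (J : {set I}) (A : I -> set R) : (forall i, measurable (A i)) ->
    (forall i, i \notin J -> g i = \1_(A i)) ->
  (\int[P]_w (\prod_i g i (X i w))%:E = (\prod_i e i)%:E)%E.
  by apply: (H [set: I]%SET (fun=> set0)) => // i; rewrite finset.in_setT.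
have [k] := ubnP #|J|; elim: k => // k IHk in J A g e mg g0 ge *.
rewrite ltnS => Jk mA gA.
have [J0|[j jJ]] := set_0Vmem J.
  have gE i : g i = \1_(A i) by rewrite gA// J0 inE.
  have eE i : (e i)%:E = P (X i @^-1` A i).
    by rewrite -ge gE integral_indic_comp.
  have := indX [set: I]%SET A mA.
  under [X in _ = X -> _]eq_bigr do rewrite -eE.
  rewrite prodEFin.
  under [X in _ = X%:E -> _]eq_bigl do rewrite finset.in_setT.
  move=> <-.
  set B := (X in P X); have mB : measurable B.
    by apply: fin_bigcap_measurable => // i _; exact: measurable_preimageT.
  transitivity (\int[P]_w (\1_B w)%:E)%E; last by rewrite integral_indic// setIT.
  apply: eq_integral => w _; congr EFin; rewrite indicE.
  under eq_bigr do rewrite gE indicE.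
  have [/set_mem wX|/negP wX] := boolP (w \in _).
    by rewrite big1// => i _; rewrite mem_set//; apply: wX; rewrite /= finset.in_setT.
  have [i Hi] : exists i, ~ A i (X i w).
    apply/existsNP => Aall; apply: wX; rewrite inE => i _; exact: Aall.
  by rewrite (bigD1 i)//= memNset ?mul0r.
pose h w := \prod_(i | i != j) g i (X i w).
pose C := \prod_(i | i != j) e i.
have e0 i : 0 <= e i.
  by rewrite -lee_fin -ge; apply: integral_ge0 => w _; rewrite lee_fin.
have mgX i : measurable_fun setT (fun w => g i (X i w)) by apply: measurableT_comp.
have mh : measurable_fun setT h.
  rewrite /h; under eq_fun do rewrite big_mkcond/=.
  apply: (measurable_prod (h := fun i w => if i != j then g i (X i w) else 1)).
  by move=> i _; case: (i != j).
transitivity (\int[P]_w (g j (X j w) * h w)%:E)%E.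
  by apply: eq_integral => w _; rewrite (bigD1 j)//=.
rewrite (@transfer_ge0_integral R _ _ _ _ _ _ P P (X j) (X j) h (cst C))//.
- under eq_integral do rewrite /= EFinM.
  rewrite ge0_integralZr ?lee_fin ?prodr_ge0//; last 2 first.
  + exact/measurable_EFinP.
  + by move=> w _; rewrite lee_fin.
  by rewrite ge -EFinM [in RHS](bigD1 j)//=.
- by move=> w; apply: prodr_ge0.
- by move=> w; apply: prodr_ge0.
(* the factor at [j] may be an indicator: apply the induction hypothesis to
   the remaining replaced coordinates *)
- move=> B mB.
  pose g' i := if i == j then \1_B else g i.
  pose e' i := if i == j then fine (P (X j @^-1` B)) else e i.
  have ej : (\int[P]_w (\1_B (X j w))%:E = (e' j)%:E)%E.
    have mXB : measurable (X j @^-1` B) by exact: measurable_preimageT.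
    by rewrite /e' eqxx fineK ?fin_num_measure// integral_indic_comp.
  transitivity (\int[P]_w (\prod_i g' i (X i w))%:E)%E.
    apply: eq_integral => w _; rewrite [in RHS](bigD1 j)//= /g' eqxx.
    by congr ((_ * _)%:E); apply: eq_bigr => i /negbTE ->.
  rewrite (IHk (J :\ j)%SET (fun i => if i == j then B else A i) g' e').
  + rewrite (bigD1 j)//= EFinM -ej.
    rewrite (_ : \prod_(i | _) _ = C); last first.
      by apply: eq_bigr => i /negbTE; rewrite /e' => ->.
    rewrite -ge0_integralZr ?lee_fin ?prodr_ge0//.
    by apply/measurable_EFinP; apply: measurableT_comp.
  + by move=> i; rewrite /g'; case: ifP.
  + by move=> i x; rewrite /g'; case: ifP.
  + move=> i; have [->|ij] := eqVneq i j; last by rewrite /g' /e' (negbTE ij).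
    by rewrite -ej /g' eqxx.
  + by move: Jk; rewrite (cardsD1 j) jJ.
  + by move=> i; case: ifP.
  + move=> i; rewrite !inE negb_and negbK /g'; have [->//|ij] := eqVneq i j.
    by move=> /=; exact: gA.
Qed.

Lemma integral_has_density (R : realType) d (T : measurableType d)
    (P : probability T R) (X : {RV P >-> R}) (f F : R -> R) :
  has_density X f -> measurable_fun setT f -> (forall x, 0 <= f x) ->
  measurable_fun setT F -> (forall x, 0 <= F x) ->
  (\int[P]_w (F (X w))%:E = \int[lebesgue_measure]_x (F x * f x)%:E)%E.
Proof.
move=> Xf mf f0 mF F0.
rewrite -(@transfer_ge0_integral R _ _ _ _ _ _ P lebesgue_measure X idfun (cst 1) f)//.
- by under [RHS]eq_integral do rewrite mulr1.
- exact: measurable_id.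
- move=> A mA; rewrite -[in RHS](integral_mkindic lebesgue_measure).
  rewrite -Xf// -[RHS]/(P (X @^-1` A)) -integral_indic_comp//.
  by apply: eq_integral => w _; rewrite mulr1.
Qed.

(** * Exponential tilting of gamma samples *)

Lemma measurable_tuple_rectangles (R : realType) (n : nat) :
  @measurable _ (n.-tuple R) = <<s [set B | exists A : 'I_n -> set R,
    (forall i, measurable (A i)) /\
    B = [set x : n.-tuple R | forall i, A i (tnth x i)] ] >>.
Proof.
apply/seteqP; split.
  apply: smallest_sub; first exact: smallest_sigma_algebra.
  move=> B; rewrite -bigcup_seq => -[/= i _ [C mC <-]].
  apply: sub_sigma_algebra; exists (fun j => if j == i then C else setT); split.
    by move=> j; case: ifP.
  apply/seteqP; split => [x [_ /= Cx] j|x /= /(_ i)]; last by rewrite eqxx.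
  by case: eqP => // ->.
apply: smallest_sub; first exact: sigma_algebra_measurable.
move=> _ [A [mA ->]].
rewrite (_ : [set _ | _] = \bigcap_(i in [set: 'I_n]) ((fun x => tnth x i) @^-1` A i)).
  apply: fin_bigcap_measurable => // i _.
  by apply: measurable_preimageT => //; exact: measurable_tnth.
by apply/seteqP; split => [x Ax i _|x Ax i]; exact: Ax.
Qed.

Lemma exists_weighted_measure (R : realType) d (T : measurableType d)
    (m : {measure set T -> \bar R}) (h : T -> R) :
  measurable_fun setT h -> (forall x, 0 <= h x) ->
  exists mh : {measure set T -> \bar R}, forall A, measurable A ->
    (mh A = \int[m]_x (\1_A x * h x)%:E)%E.
Proof.
move=> mh h0.
pose nu A := (\int[m]_(x in A) (h x)%:E)%E.
have nu0 : nu set0 = 0%E by rewrite /nu integral_set0.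
have nu_ge0 A : (0 <= nu A)%E.
  by apply: integral_ge0 => x _; rewrite lee_fin.
have nuS : semi_sigma_additive nu.
  move=> F mF tF mUF; rewrite /nu; apply: cvg_toP.
    apply: ereal_nondecreasing_is_cvgn => k l kl.
    by apply: lee_sum_nneg_natr => // i _ _; exact: nu_ge0.
  rewrite ge0_integral_bigcup//=.
  - by apply/measurable_funTS/measurable_EFinP.
  - by move=> x _; rewrite lee_fin.
pose nuM : {measure set T -> \bar R} := HB.pack nu (isMeasure.Build _ _ _ nu nu0 nu_ge0 nuS).
by exists nuM => A mA; rewrite -integral_mkindic.
Qed.

Lemma gamma_pdfE (R : realType) (alpha x : R) : gamma_pdf alpha x =
  \1_(`]0, +oo[%classic : set R) x * ((Gamma alpha)^-1 * gamma_kernel alpha x).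
Proof.
rewrite /gamma_pdf patchE indicE; case: ifPn => _; rewrite ?mul0r// mul1r.
by rewrite /gamma_kernel; ring.
Qed.

Lemma gamma_pdf_ge0 (R : realType) (alpha x : R) : 0 < alpha ->
  0 <= gamma_pdf alpha x.
Proof.
move=> a0; rewrite gamma_pdfE mulr_ge0// mulr_ge0 ?gamma_kernel_ge0//.
by rewrite invr_ge0 ltW// Gamma_gt0.
Qed.

Lemma measurable_gamma_pdf (R : realType) (alpha : R) :
  measurable_fun setT (gamma_pdf alpha).
Proof.
rewrite (_ : gamma_pdf alpha = (fun x => \1_(`]0, +oo[%classic : set R) x *
    ((Gamma alpha)^-1 * gamma_kernel alpha x))); last first.
  by apply/funext => x; exact: gamma_pdfE.
by apply: measurable_funM => //; apply: measurable_funM => //; exact: measurable_gamma_kernel.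
Qed.

(** The ratio at [x] of the density of [c X] to the density of [X], when [X]
    has the gamma density of parameter [alpha]. *)
Definition tilt (R : realType) (alpha c x : R) : R :=
  c `^ (- alpha) * expR ((1 - c^-1) * x).

Lemma tilt_ge0 (R : realType) (alpha c x : R) : 0 <= tilt alpha c x.
Proof. by rewrite mulr_ge0 ?powR_ge0 ?expR_ge0. Qed.

Lemma measurable_tilt (R : realType) (alpha c : R) :
  measurable_fun setT (tilt alpha c).
Proof.
by apply: measurable_funM => //; apply: measurableT_comp => //; exact: measurable_funM.
Qed.

Lemma integral_tilt1 (R : realType) (alpha c : R) d (T : measurableType d)
    (P : probability T R) (X : {RV P >-> R}) (F : R -> R) :
  0 < alpha -> 0 < c -> has_density X (gamma_pdf alpha) ->
  measurable_fun setT F -> (forall x, 0 <= F x) ->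
  (\int[P]_w (F (c * X w))%:E = \int[P]_w (F (X w) * tilt alpha c (X w))%:E)%E.
Proof.
move=> a0 c0 dX mF F0.
have mFc : measurable_fun setT (fun x => F (c * x)).
  by apply: measurableT_comp => //; exact: measurable_scale.
rewrite (integral_has_density dX _ _ mFc)//; last 2 first.
- exact: measurable_gamma_pdf.
- by move=> x; exact: gamma_pdf_ge0.
have mFt : measurable_fun setT (fun x => F x * tilt alpha c x).
  by apply: measurable_funM => //; exact: measurable_tilt.
rewrite (integral_has_density dX _ _ mFt); last 3 first.
- exact: measurable_gamma_pdf.
- by move=> x; exact: gamma_pdf_ge0.
- by move=> x; rewrite mulr_ge0 ?tilt_ge0.
rewrite [RHS](@ge0_integral_scale _ c) ?gt_eqF//; last 2 first.
- by apply: measurable_funM => //; exact: measurable_gamma_pdf.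
- by move=> x; rewrite mulr_ge0 ?gamma_pdf_ge0// mulr_ge0 ?tilt_ge0.
rewrite -ge0_integralZl ?lee_fin//; last 2 first.
- apply/measurable_EFinP.
  apply: (measurableT_comp (f := fun x => F x * tilt alpha c x * gamma_pdf alpha x)).
    by apply: measurable_funM => //; exact: measurable_gamma_pdf.
  exact: measurable_scale.
- by move=> x _; rewrite lee_fin mulr_ge0 ?gamma_pdf_ge0// mulr_ge0 ?tilt_ge0.
apply: eq_integral => x _; rewrite -EFinM; congr EFin.
rewrite !gamma_pdfE !indic_itv0y pmulr_rgt0// gtr0_norm//.
have [x0|x0] := ltP 0 x; last by rewrite !mul0r !mulr0.
rewrite !mul1r /tilt /gamma_kernel powRM ?ltW//.
have E : c `^ (- alpha) * (c * c `^ (alpha - 1)) = 1.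
  rewrite mulr_powRB1 ?ltW// -powRD ?(gt_eqF c0) ?implybT//.
  by rewrite addNr powRr0.
have E' : expR ((1 - c^-1) * (c * x)) * expR (- (c * x)) = expR (- x).
  by rewrite -expRD; congr expR; field; rewrite (lt0r_neq0 c0).
by rewrite -E' -[LHS]mul1r -[X in X * _ = _]E; ring.
Qed.

(** The law of [c X] and the law of [X] weighted by the product of the tilts
    are finite measures that agree on rectangles, by independence and the
    one-dimensional identity. *)
Lemma integral_tilt_tuple (R : realType) (n : nat) (alpha c : R) d
    (T : measurableType d) (P : probability T R) (X : 'I_n -> {RV P >-> R})
    (F : n.-tuple R -> R) :
  0 < alpha -> 0 < c -> mutually_independent X ->
  (forall i, has_density (X i) (gamma_pdf alpha)) ->
  measurable_fun setT F -> (forall x, 0 <= F x) ->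
  (\int[P]_w (F [tuple c * X i w | i < n])%:E =
   \int[P]_w (F [tuple X i w | i < n] * \prod_(i < n) tilt alpha c (X i w))%:E)%E.
Proof.
move=> a0 c0 indX dX mF F0.
pose V1 w := [tuple c * X i w | i < n].
pose V2 w := [tuple X i w | i < n].
pose h w := \prod_(i < n) tilt alpha c (X i w).
have mV1 : measurable_fun setT V1.
  apply/measurable_fun_tnthP => i.
  rewrite (_ : _ \o _ = (fun w => c * X i w)); first exact: measurable_funM.
  by apply/funext => w /=; rewrite tnth_mktuple.
have mV2 : measurable_fun setT V2.
  apply/measurable_fun_tnthP => i.
  rewrite (_ : _ \o _ = X i)//.
  by apply/funext => w /=; rewrite tnth_mktuple.
have mh : measurable_fun setT h.
  apply: measurable_prod => i _; apply: measurableT_comp => //.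
  exact: measurable_tilt.
have h0 w : 0 <= h w by apply: prodr_ge0 => i _; exact: tilt_ge0.
rewrite -(@transfer_ge0_integral R _ _ _ _ _ _ P P V1 V2 (cst 1) h)//.
  by apply: eq_integral => w _; rewrite mulr1.
have [m2 m2E] := exists_weighted_measure P mh h0.
suff H : forall A, measurable A -> pushforward P V1 A = pushforward m2 V2 A.
  move=> A mA; under eq_integral do rewrite mulr1.
  rewrite integral_indic_comp// -[LHS]/(pushforward P V1 A) H// /pushforward m2E//.
  exact: measurable_preimageT.
apply: (measure_unique _ (fun=> setT) (measurable_tuple_rectangles R n)).
- move=> _ _ [A [mA ->]] [B [mB ->]].
  exists (fun i => A i `&` B i); split; first by move=> i; exact: measurableI.
  apply/seteqP; split => x /=; first by move=> [Ax Bx] i.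
  by move=> ABx; split => i; have [] := ABx i.
- by move=> _; exists (fun=> setT); split => //; apply/seteqP; split.
- by rewrite bigcup_const//; exists 0%N.
- move=> _ [A [mA ->]].
  have mXA i : measurable (X i @^-1` A i) by exact: measurable_preimageT.
  pose e i := fine (\int[P]_w (\1_(A i) (c * X i w))%:E)%E.
  have Pe i : (\int[P]_w (\1_(A i) (c * X i w))%:E = (e i)%:E)%E.
    rewrite fineK// (@integral_indic_comp _ _ _ _ _ P (fun w => c * X i w))//.
      by apply: fin_num_measure; apply: measurable_preimageT => //; exact: measurable_funM.
    exact: measurable_funM.
  have p1 := integral_prod_independent (g := fun i x => \1_(A i) (c * x)) (e := e) indX.
  have p2 := integral_prod_independent (g := fun i x => \1_(A i) x * tilt alpha c x) (e := e) indX.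
  have prodE (x : 'I_n -> R) : \prod_(i < n) \1_(A i) (x i) =
      \1_[set y : n.-tuple R | forall i, A i (tnth y i)] [tuple x i | i < n] :> R.
    rewrite [RHS]indicE; have [/set_mem/= xA|/negP xA] := boolP (_ \in _).
      by apply: big1 => i _; have := xA i; rewrite tnth_mktuple indicE => /mem_set ->.
    have [i Hi] : exists i, ~ A i (x i).
      apply/existsNP => Aall; apply: xA; rewrite inE/= => i.
      by rewrite tnth_mktuple.
    by rewrite (bigD1 i)//= indicE memNset ?mul0r.
  have mrect : measurable [set x : n.-tuple R | forall i, A i (tnth x i)].
    by rewrite measurable_tuple_rectangles; apply: sub_sigma_algebra; exists A.
  pose B := [set x : n.-tuple R | forall i, A i (tnth x i)].
  rewrite -[LHS]/(P (V1 @^-1` B)) -[RHS]/(m2 (V2 @^-1` B)) m2E; last first.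
    exact: measurable_preimageT.
  rewrite -integral_indic_comp//.
  transitivity ((\prod_i e i)%:E).
    rewrite -p1//.
    + by apply: eq_integral => w _; rewrite prodE.
    + by move=> i; apply: measurableT_comp => //; exact: measurable_scale.
  rewrite -p2//.
  + apply: eq_integral => w _; rewrite big_split/= prodE; congr ((_ * _)%:E).
  + by move=> i; apply: measurable_funM => //; exact: measurable_tilt.
  + by move=> i x; rewrite mulr_ge0 ?tilt_ge0.
  + move=> i; rewrite -Pe (integral_tilt1 (F := \1_(A i)) a0 c0 (dX i))//.
- by move=> _; rewrite -[X in (X < _)%E]/(P setT) probability_setT ltry.
Qed.

(** * Separation of scale and direction *)

Lemma measurable_invr (R : realType) : measurable_fun setT (@GRing.inv R).
Proof.
rewrite (_ : GRing.inv = (fun x : R => x * (x ^+ 2) `^ (-1))).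
  apply: measurable_funM => //.
  by apply: (measurableT_comp (measurable_powR _)); exact: measurable_funX.
apply/funext => x; rewrite powR_inv1 ?sqr_ge0//.
have [->|x0] := eqVneq x 0; first by rewrite mul0r invr0.
by rewrite expr2 invfM mulrA divff// mul1r.
Qed.

Lemma gamma_pdf_pos_ae (R : realType) (alpha : R) d (T : measurableType d)
    (P : probability T R) (X : {RV P >-> R}) : 0 < alpha ->
  has_density X (gamma_pdf alpha) -> {ae P, forall w, 0 < X w}.
Proof.
move=> a0 dX; exists [set w | X w <= 0]; split.
- rewrite (_ : [set _ | _] = X @^-1` `]-oo, 0]).
    by apply: measurable_preimageT => //; exact: measurable_itv.
  by apply/seteqP; split => w /=; rewrite in_itv.
- rewrite (_ : [set _ | _] = X @^-1` `]-oo, 0]); last first.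
    by apply/seteqP; split => w /=; rewrite in_itv.
  rewrite -[LHS]/(distribution P X _) dX//.
  apply: integral0_eq => x /=; rewrite in_itv/= => x0.
  by rewrite gamma_pdfE indic_itv0y ltNge x0 mul0r.
- by move=> w /= /negP; rewrite -leNgt.
Qed.

Definition rv_sum (R : realType) d (T : measurableType d) (P : probability T R)
  (n : nat) (X : 'I_n -> {RV P >-> R}) (w : T) : R := \sum_(i < n) X i w.

Definition rv_sumsq (R : realType) d (T : measurableType d) (P : probability T R)
  (n : nat) (X : 'I_n -> {RV P >-> R}) (w : T) : R := \sum_(i < n) X i w ^+ 2.

Lemma measurable_rv_sum (R : realType) d (T : measurableType d)
    (P : probability T R) (n : nat) (X : 'I_n -> {RV P >-> R}) :
  measurable_fun setT (rv_sum X).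
Proof. exact: measurable_sum. Qed.

Lemma measurable_rv_sumsq (R : realType) d (T : measurableType d)
    (P : probability T R) (n : nat) (X : 'I_n -> {RV P >-> R}) :
  measurable_fun setT (rv_sumsq X).
Proof. by apply: measurable_sum => i; exact: measurable_funX. Qed.

Lemma rv_sum_gt0_ae (R : realType) (alpha : R) (n : nat) d (T : measurableType d)
    (P : probability T R) (X : 'I_n -> {RV P >-> R}) : (0 < n)%N -> 0 < alpha ->
  (forall i, has_density (X i) (gamma_pdf alpha)) ->
  {ae P, forall w, 0 < rv_sum X w /\ 0 < rv_sumsq X w}.
Proof.
move=> n0 a0 dX.
have : {ae P, forall w i, 0 < X i w}.
  by apply: filter_forall => i; exact: (gamma_pdf_pos_ae a0 (dX i)).
apply: filterS => w Xw; split; rewrite /rv_sum /rv_sumsq;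
  rewrite (bigD1 (Ordinal n0))//= ltr_wpDr ?exprn_gt0//; apply: sumr_ge0 => i _.
- exact: ltW.
- exact: sqr_ge0.
Qed.

(** The tilts multiply to a function of the sum alone, so the identity
    descends to the pair of sums. *)
Lemma integral_tilt_sum_sumsq (R : realType) (n : nat) (alpha c : R) d
    (T : measurableType d) (P : probability T R) (X : 'I_n -> {RV P >-> R})
    (g : R * R -> R) :
  0 < alpha -> 0 < c -> mutually_independent X ->
  (forall i, has_density (X i) (gamma_pdf alpha)) ->
  measurable_fun setT g -> (forall x, 0 <= g x) ->
  (\int[P]_w (g (c * rv_sum X w, c ^+ 2 * rv_sumsq X w))%:E =
   \int[P]_w (g (rv_sum X w, rv_sumsq X w) * tilt (alpha * n%:R) c (rv_sum X w))%:E)%E.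
Proof.
move=> a0 c0 indX dX mg g0.
pose F (x : n.-tuple R) := g (\sum_(i < n) tnth x i, \sum_(i < n) tnth x i ^+ 2).
have mF : measurable_fun setT F.
  apply: measurableT_comp => //; apply: measurable_fun_pair.
    by apply: measurable_sum => i; exact: measurable_tnth.
  by apply: measurable_sum => i; apply: measurable_funX; exact: measurable_tnth.
have F0 x : 0 <= F x by exact: g0.
have := integral_tilt_tuple a0 c0 indX dX mF F0.
rewrite /F => H; transitivity (\int[P]_w
    (g (\sum_(i < n) tnth [tuple c * X i w | i < n] i,
        \sum_(i < n) tnth [tuple c * X i w | i < n] i ^+ 2))%:E)%E.
  apply: eq_integral => w _; congr ((g (_, _))%:E).
    by rewrite mulr_sumr; apply: eq_bigr => i _; rewrite tnth_mktuple.
  by rewrite mulr_sumr; apply: eq_bigr => i _; rewrite tnth_mktuple exprMn.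
rewrite H; apply: eq_integral => w _; congr ((g (_, _) * _)%:E).
- by apply: eq_bigr => i _; rewrite tnth_mktuple.
- by apply: eq_bigr => i _; rewrite tnth_mktuple.
rewrite /tilt big_split/= prodr_const card_ord -expR_sum -mulr_sumr; congr (_ * _).
by rewrite -mulNr powRrM powR_mulrn// powR_ge0.
Qed.

(** The integrand of the polar decomposition in the scale variable [u]. *)
Definition polar_kernel (R : realType) (a : R) (g : R * R -> R) (s q u : R) : R :=
  u^-1 * (s / u) `^ a * expR (- (s / u)) * g (s / u, q / u ^+ 2).

Lemma polar_kernel_ge0 (R : realType) (a : R) (g : R * R -> R) (s q u : R) :
  (forall z, 0 <= g z) -> 0 < u -> 0 <= polar_kernel a g s q u.
Proof.
move=> g0 u0; rewrite mulr_ge0// mulr_ge0 ?expR_ge0// mulr_ge0 ?powR_ge0//.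
by rewrite invr_ge0 ltW.
Qed.

Lemma measurable_polar_kernel (R : realType) d (T : measurableType d) (a : R)
    (g : R * R -> R) (S Q : T -> R) :
  measurable_fun setT g -> measurable_fun setT S -> measurable_fun setT Q ->
  measurable_fun setT (fun z : T * R => polar_kernel a g (S z.1) (Q z.1) z.2).
Proof.
move=> mg mS mQ.
have mV : measurable_fun setT (fun z : T * R => z.2^-1).
  by apply: measurableT_comp => //; exact: measurable_invr.
have mSu : measurable_fun setT (fun z : T * R => S z.1 / z.2).
  by apply: measurable_funM => //; exact: measurableT_comp.
have mQu : measurable_fun setT (fun z : T * R => Q z.1 / z.2 ^+ 2).
  apply: measurable_funM; first exact: measurableT_comp.
  by apply: (measurableT_comp (@measurable_invr R)); exact: measurable_funX.
apply: measurable_funM; last by apply: measurableT_comp => //; exact: measurable_fun_pair.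
apply: measurable_funM; last by apply: measurableT_comp => //; exact: measurableT_comp.
by apply: measurable_funM => //; exact: (measurableT_comp (measurable_powR _)).
Qed.

Lemma measurable_integral_polar_kernel (R : realType) d (T : measurableType d) (a : R)
    (g : R * R -> R) (S Q : T -> R) :
  measurable_fun setT g -> (forall z, 0 <= g z) ->
  measurable_fun setT S -> measurable_fun setT Q ->
  measurable_fun setT (fun w => \int[lebesgue_measure]_(u in `]0%R, +oo[)
    (polar_kernel a g (S w) (Q w) u)%:E)%E.
Proof.
move=> mg g0 mS mQ.
pose f (z : T * R) := (\1_(`]0, +oo[%classic : set R) z.2 *
  polar_kernel a g (S z.1) (Q z.1) z.2)%:E.
have mf : measurable_fun setT f.
  apply/measurable_EFinP; apply: measurable_funM; last exact: measurable_polar_kernel.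
  by apply: measurableT_comp => //; exact: measurable_indic.
have f0 z : (0 <= f z)%E.
  rewrite lee_fin /= indic_itv0y; case: (ltP 0 z.2) => z0; last by rewrite mul0r.
  by rewrite mul1r polar_kernel_ge0.
rewrite (_ : (fun w => _) = fun w => (\int[lebesgue_measure]_u f (w, u))%E).
  exact: measurable_fun_fubini_tonelli_F.
by apply/funext => w; rewrite integral_mkindic.
Qed.

(** For fixed [u > 0], tilting by [c = 1 / u] turns the expectation of
    [g(S, Q) S^a u^(a - 1) exp (- u S)] into that of the polar kernel.
    Integrating over [u] on both sides gives the claim, as
    [int_0^oo u^(a - 1) exp (- u S) du = S^(- a) Gamma a] almost surely. *)
Lemma polar_decomposition (R : realType) (n : nat) (alpha : R) d
    (T : measurableType d) (P : probability T R) (X : 'I_n -> {RV P >-> R})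
    (g : R * R -> R) :
  (0 < n)%N -> 0 < alpha -> mutually_independent X ->
  (forall i, has_density (X i) (gamma_pdf alpha)) ->
  measurable_fun setT g -> (forall x, 0 <= g x) ->
  ((Gamma (alpha * n%:R))%:E * \int[P]_w (g (rv_sum X w, rv_sumsq X w))%:E =
   \int[P]_w \int[lebesgue_measure]_(u in `]0%R, +oo[)
    (polar_kernel (alpha * n%:R) g (rv_sum X w) (rv_sumsq X w) u)%:E)%E.
Proof.
move=> n0 a0 indX dX mg g0.
set a := alpha * n%:R; have a_gt0 : 0 < a by rewrite mulr_gt0 ?ltr0n.
pose S := rv_sum X; pose Q := rv_sumsq X.
have mS : measurable_fun setT S by exact: measurable_rv_sum.
have mQ : measurable_fun setT Q by exact: measurable_rv_sumsq.
have mgSQ : measurable_fun setT (fun w => g (S w, Q w)).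
  by apply: measurableT_comp => //; exact: measurable_fun_pair.
pose f1 (z : T * R) := (\1_(`]0, +oo[%classic : set R) z.2 *
  (g (S z.1, Q z.1) * (S z.1 `^ a * (z.2 `^ (a - 1) * expR (- (S z.1 * z.2))))))%:E.
pose f2 (z : T * R) := (\1_(`]0, +oo[%classic : set R) z.2 *
  polar_kernel a g (S z.1) (Q z.1) z.2)%:E.
have m1 : measurable_fun setT (fun z : T * R => S z.1) by exact: measurableT_comp.
have m4 : measurable_fun setT (fun z : T * R => \1_(`]0, +oo[%classic : set R) z.2 : R).
  by apply: measurableT_comp => //; exact: measurable_indic.
have mf1 : measurable_fun setT f1.
  apply/measurable_EFinP; apply: measurable_funM => //; apply: measurable_funM.
    exact: (measurableT_comp mgSQ).
  apply: measurable_funM; first by apply: (measurableT_comp (measurable_powR _)).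
  apply: measurable_funM; first by apply: (measurableT_comp (measurable_powR _)).
  apply: measurableT_comp => //; apply: measurableT_comp => //.
  exact: measurable_funM.
have mf2 : measurable_fun setT f2.
  by apply/measurable_EFinP; apply: measurable_funM => //; exact: measurable_polar_kernel.
have f10 z : (0 <= f1 z)%E.
  by rewrite lee_fin; do 4![rewrite mulr_ge0 ?powR_ge0 ?expR_ge0//].
have f20 z : (0 <= f2 z)%E.
  rewrite lee_fin /= indic_itv0y; case: (ltP 0 z.2) => z0; last by rewrite mul0r.
  by rewrite mul1r polar_kernel_ge0.
transitivity (\int[P]_w \int[lebesgue_measure]_u f1 (w, u))%E.
  rewrite -ge0_integralZl ?lee_fin ?(ltW (Gamma_gt0 a_gt0))//; last 2 first.
  - exact/measurable_EFinP.
  - by move=> w _; rewrite lee_fin.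
  apply: ge0_ae_eq_integral => //.
  - by apply/measurable_EFinP; exact: measurable_funM.
  - exact: measurable_fun_fubini_tonelli_F.
  - by move=> w _; rewrite -EFinM lee_fin mulr_ge0 ?(ltW (Gamma_gt0 a_gt0)).
  - by move=> w _; apply: integral_ge0.
  apply: filterS (rv_sum_gt0_ae n0 a0 dX) => w [Sw _] _.
  have := integral_power_gamma a_gt0 (oner_neq0 R) Sw.
  rewrite integral_mkindic normr1 divr1 mulr1 => E.
  transitivity ((g (S w, Q w) * S w `^ a)%:E * (S w `^ (- a) * Gamma a)%:E)%E.
    rewrite -!EFinM; congr EFin.
    have : S w `^ a * S w `^ (- a) = 1.
      by rewrite -powRD ?subrr ?powRr0// (gt_eqF Sw) implybT.
    by move=> E1; rewrite -[LHS]mulr1 -[X in _ * X = _]E1; ring.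
  rewrite -E -ge0_integralZl ?lee_fin ?mulr_ge0 ?powR_ge0//; last 2 first.
  - apply/measurable_EFinP; apply: measurable_funM => //.
    apply: measurable_funM; first exact: measurable_powR.
    apply: measurableT_comp => //; apply: measurableT_comp => //.
    by apply: measurable_funM => //; exact: measurable_powR.
  - by move=> u _; rewrite lee_fin mulr_ge0// mulr_ge0 ?powR_ge0 ?expR_ge0.
  apply: eq_integral => u _; rewrite -EFinM /f1/= indic_itv0y; congr EFin.
  have [u0|u0] := ltP 0 u; last by rewrite !mul0r mulr0.
  by rewrite powRr1 ?ltW// /S; ring.
transitivity (\int[P]_w \int[lebesgue_measure]_u f2 (w, u))%E; last first.
  by apply: eq_integral => w _; rewrite [RHS]integral_mkindic.
transitivity (\int[lebesgue_measure]_u \int[P]_w f1 (w, u))%E.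
  by rewrite fubini_tonelli.
transitivity (\int[lebesgue_measure]_u \int[P]_w f2 (w, u))%E; last first.
  by rewrite fubini_tonelli.
apply: eq_integral => u _.
have [u0|u0] := ltP 0 u; last first.
  by rewrite !integral0_eq// => w _; rewrite /f1 /f2/= indic_itv0y ltNge u0 mul0r.
have uV0 : 0 < u^-1 by rewrite invr_gt0.
(* tilt by [c = u^-1] the function [g'], which carries the factor [exp (- S)]
   left over by the tilt *)
pose g' (z : R * R) := u^-1 * z.1 `^ a * expR (- z.1) * g z.
have mg' : measurable_fun setT g'.
  apply: measurable_funM => //; apply: measurable_funM => //.
    by apply: measurable_funM => //; apply: (measurableT_comp (measurable_powR _)).
  by apply: measurableT_comp => //; apply: measurableT_comp.
have g'0 z : 0 <= g' z.
  by do 3![rewrite mulr_ge0 ?(ltW uV0) ?powR_ge0 ?expR_ge0//].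
transitivity (\int[P]_w (g' (u^-1 * S w, u^-1 ^+ 2 * Q w))%:E)%E; last first.
  apply: eq_integral => w _; rewrite /f2 /polar_kernel /g' indic_itv0y u0 mul1r/=.
  by rewrite [u^-1 * S w]mulrC exprVn [(u ^+ 2)^-1 * Q w]mulrC.
rewrite (integral_tilt_sum_sumsq a0)//; apply: eq_integral => w _.
rewrite /f1 /g' /tilt/= indic_itv0y u0 mul1r; congr EFin.
rewrite invrK -powR_inv1 ?(ltW u0)// -powRrM -/S -/Q -/a.
have -> : expR ((1 - u) * S w) = expR (S w) * expR (- (S w * u)).
  by rewrite -expRD; congr expR; ring.
have E1 : expR (- S w) * expR (S w) = 1 by rewrite -expRD addNr expR0.
have -> : u `^ (a - 1) = u `^ (-1) * u `^ (-1 * - a).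
  by rewrite -powRD ?(gt_eqF u0) ?implybT//; congr (_ `^ _); ring.
by rewrite -[LHS]mul1r -[X in X * _ = _]E1; ring.
Qed.

(** * The multinomial formula *)

(** In degrees at most [k], the truncated exponential series multiply like
    the exponentials themselves. *)
Lemma coef_prod_exp_trunc (F : numFieldType) (I : Type) (s : seq I) (x : I -> F)
    (k j : nat) : (j <= k)%N ->
  (\prod_(i <- s) \poly_(l < k.+1) (x i ^+ l / l`!%:R))`_j =
  (\sum_(i <- s) x i) ^+ j / j`!%:R.
Proof.
elim: s j => [|i s IHs] j jk.
  rewrite !big_nil coef1; case: j jk => [|j] _; first by rewrite expr0 fact0 divr1.
  by rewrite expr0n/= mul0r.
rewrite !big_cons coefM addrC exprDn mulr_suml; apply: eq_bigr => l _.
have lj : (l <= j)%N by rewrite -ltnS.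
rewrite coef_poly ltnS (leq_trans lj jk) IHs ?(leq_trans (leq_subr _ _))//.
have fact_neq0 m : m`!%:R != 0 :> F by rewrite pnatr_eq0 -lt0n fact_gt0.
have -> : j`!%:R = ('C(j, l))%:R * (l`!%:R * (j - l)`!%:R) :> F.
  by rewrite -!natrM bin_fact.
have bin_neq0 : ('C(j, l))%:R != 0 :> F by rewrite pnatr_eq0 -lt0n bin_gt0.
rewrite -mulr_natr; field.
by rewrite !fact_neq0 bin_neq0.
Qed.

(** Compare the coefficients of degree [k] in a product of truncated
    exponential series. *)
Lemma multinomial_formula (F : numFieldType) (n k : nat) (x : 'I_n -> F) :
  (\sum_(i < n) x i) ^+ k = k`!%:R *
    \sum_(c : {ffun 'I_n -> 'I_k.+1} | (\sum_(i < n) c i)%N == k)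
      \prod_(i < n) (x i ^+ c i / (c i)`!%:R).
Proof.
have k_neq0 : k`!%:R != 0 :> F by rewrite pnatr_eq0 -lt0n fact_gt0.
suff -> : \sum_(c : {ffun 'I_n -> 'I_k.+1} | (\sum_(i < n) c i)%N == k)
    \prod_(i < n) (x i ^+ c i / (c i)`!%:R) = (\sum_(i < n) x i) ^+ k / k`!%:R.
  by rewrite mulrC divfK.
rewrite -(@coef_prod_exp_trunc _ _ _ _ k)//.
under [in RHS]eq_bigr do rewrite poly_def.
rewrite bigA_distr_bigA/= coef_sum big_mkcond/=; apply: eq_bigr => c _.
have -> : \prod_(i < n) ((x i ^+ c i / (c i)`!%:R) *: 'X^(c i)) =
    (\prod_(i < n) (x i ^+ c i / (c i)`!%:R)) *: 'X^(\sum_(i < n) c i) :> {poly F}.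
  by rewrite scaler_prod prodrXr.
rewrite coefZ coefXn eq_sym.
by case: eqP => _; rewrite ?mulr1 ?mulr0.
Qed.

(** * The angle with the diagonal *)

(** The random variable [sqrt n * cos Phi], see [sqrt_cos_Phi]. *)
Definition rv_ratio (R : realType) d (T : measurableType d) (P : probability T R)
  (n : nat) (X : 'I_n -> {RV P >-> R}) (w : T) : R :=
  rv_sum X w / Num.sqrt (rv_sumsq X w).

Lemma measurable_sqrtr (R : realType) : measurable_fun setT (@Num.sqrt R).
Proof. by apply: continuous_measurable_fun; exact: sqrt_continuous. Qed.

Lemma measurable_rv_ratio (R : realType) d (T : measurableType d)
    (P : probability T R) (n : nat) (X : 'I_n -> {RV P >-> R}) :
  measurable_fun setT (rv_ratio X).
Proof.
apply: measurable_funM; first exact: measurable_rv_sum.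
apply: (measurableT_comp (@measurable_invr R)).
by apply: (measurableT_comp (@measurable_sqrtr R)); exact: measurable_rv_sumsq.
Qed.

(** Cauchy-Schwarz, from the nonnegativity of the empirical variance. *)
Lemma sqr_rv_sum_le (R : realType) d (T : measurableType d)
    (P : probability T R) (n : nat) (X : 'I_n -> {RV P >-> R}) (w : T) :
  rv_sum X w ^+ 2 <= n%:R * rv_sumsq X w.
Proof.
case: n X => [|n] X; first by rewrite /rv_sum big_ord0 expr0n/= mul0r.
set m := rv_sum X w / n.+1%:R.
have n0 : 0 < n.+1%:R :> R by rewrite ltr0n.
have : 0 <= \sum_(i < n.+1) (X i w - m) ^+ 2.
  by apply: sumr_ge0 => i _; exact: sqr_ge0.
under eq_bigr do rewrite sqrrB.
rewrite big_split sumrB/= -/(rv_sumsq X w) sumr_const card_ord.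
rewrite -(pmulr_rge0 _ n0) => H; rewrite -subr_ge0; move: H; congr (_ <= _).
rewrite sumrMnl -mulr_suml -/(rv_sum X w) /m -mulr_natr.
rewrite -[X in _ + X]mulr_natr; move: (n.+1%:R : R) n0 => N n0; field.
by rewrite (lt0r_neq0 n0).
Qed.

Lemma normr_rv_ratio_le (R : realType) d (T : measurableType d)
    (P : probability T R) (n : nat) (X : 'I_n -> {RV P >-> R}) (w : T) :
  `|rv_ratio X w| <= Num.sqrt n%:R.
Proof.
have Q0 : 0 <= rv_sumsq X w by apply: sumr_ge0 => i _; exact: sqr_ge0.
rewrite -ler_sqr ?nnegrE ?sqrtr_ge0// sqr_sqrtr ?ler0n// real_normK ?num_real//.
rewrite /rv_ratio expr_div_n sqr_sqrtr//.
have [Qp|Q0'] := ltP 0 (rv_sumsq X w); first by rewrite ler_pdivrMr// sqr_rv_sum_le.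
by rewrite (_ : rv_sumsq X w = 0) ?invr0 ?mulr0 ?ler0n//; apply/eqP; rewrite eq_le Q0'.
Qed.

Lemma sqrt_cos_Phi (R : realType) d (T : measurableType d)
    (P : probability T R) (n : nat) (X : 'I_n -> {RV P >-> R}) (w : T) : (0 < n)%N ->
  Num.sqrt n%:R * cos (Phi X w) = rv_ratio X w.
Proof.
move=> n0; have sn0 : 0 < Num.sqrt n%:R :> R by rewrite sqrtr_gt0 ltr0n.
pose u : 'rV[R]_n := \row_i X i w; pose v : 'rV[R]_n := const_mx 1.
have uv : dot u v = rv_sum X w.
  by apply: eq_bigr => i _; rewrite !mxE mulr1.
have uu : dot u u = rv_sumsq X w.
  by apply: eq_bigr => i _; rewrite !mxE expr2.
have vv : dot v v = n%:R.
  rewrite /dot; under eq_bigr do rewrite !mxE mulr1.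
  by rewrite sumr_const card_ord.
have E : dot u v / (enorm u * enorm v) = rv_ratio X w / Num.sqrt n%:R.
  by rewrite /enorm uv uu vv invfM mulrA.
rewrite /Phi /angle -/u -/v E acosK; first by rewrite mulrC divfK ?gt_eqF.
rewrite in_itv/= -ler_norml normrM normfV (ger0_norm (ltW sn0)).
by rewrite ler_pdivrMr// mul1r normr_rv_ratio_le.
Qed.

(** * Moments of the cosine of the angle *)

(** Multiplying the gamma density by this weight replaces its exponential
    factor by a Gaussian one and raises the power by [j]. The absolute value
    makes the weight nonnegative on the whole line. *)
Definition gauss_weight (R : realType) (j : nat) (x : R) : R :=
  `|x| ^+ j / j`!%:R * expR (x - x ^+ 2).

Lemma gauss_weight_ge0 (R : realType) (j : nat) (x : R) : 0 <= gauss_weight j x.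
Proof. by rewrite mulr_ge0 ?expR_ge0// divr_ge0 ?exprn_ge0. Qed.

Lemma measurable_gauss_weight (R : realType) (j : nat) :
  measurable_fun setT (@gauss_weight R j).
Proof.
apply: measurable_funM.
  by apply: measurable_funM => //; apply: measurable_funX; exact: normr_measurable.
by apply: measurableT_comp => //; apply: measurable_funB => //.
Qed.

Lemma integral_gauss_weight (R : realType) (alpha : R) (j : nat) d
    (T : measurableType d) (P : probability T R) (X : {RV P >-> R}) :
  0 < alpha -> has_density X (gamma_pdf alpha) ->
  (\int[P]_w (gauss_weight j (X w))%:E =
   ((2 * Gamma alpha)^-1 * (Gamma ((alpha + j%:R) / 2) / j`!%:R))%:E)%E.
Proof.
move=> a0 dX.
rewrite (integral_has_density dX _ _ (@measurable_gauss_weight R j)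
  (@gauss_weight_ge0 R j)); last 2 first.
- exact: measurable_gamma_pdf.
- by move=> x; exact: gamma_pdf_ge0.
have aj0 : 0 < (alpha + j%:R) / 2 by rewrite divr_gt0// ltr_wpDr.
have := integral_power_gamma aj0 (lt0r_neq0 (ltr0Sn R 1)) ltr01.
rewrite integral_mkindic powR1 mul1r ger0_norm// => E.
have Ga0 := Gamma_gt0 a0.
transitivity (((Gamma alpha)^-1 / j`!%:R)%:E * (Gamma ((alpha + j%:R) / 2) / 2)%:E)%E; last first.
  rewrite -EFinM; congr EFin; rewrite invfM; ring.
rewrite -E -ge0_integralZl ?lee_fin ?divr_ge0 ?invr_ge0 ?(ltW Ga0)//; last 2 first.
- apply/measurable_EFinP; apply: measurable_funM => //.
  apply: measurable_funM; first exact: measurable_powR.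
  apply: measurableT_comp => //; apply: measurableT_comp => //.
  by apply: measurable_funM => //; exact: measurable_powR.
- by move=> x _; rewrite lee_fin mulr_ge0// mulr_ge0 ?powR_ge0 ?expR_ge0.
apply: eq_integral => x _; rewrite -EFinM; congr EFin.
rewrite gamma_pdfE indic_itv0y; have [x0|x0] := ltP 0 x; last by rewrite !mul0r !mulr0.
rewrite !mul1r /gauss_weight /gamma_kernel ger0_norm ?(ltW x0)//.
rewrite (_ : _ / 2 * 2 - 1 = (alpha - 1) + j%:R); last by field.
rewrite [x `^ (alpha - 1 + _)]powRD ?(gt_eqF x0) ?implybT// !powR_mulrn ?ltW//.
have -> : expR (- x ^+ 2) = expR (x - x ^+ 2) * expR (- x).
  by rewrite -expRD; congr expR; ring.
ring.
Qed.

(** The multinomial expansion of [S^k] and [S - Q = sum (X_i - X_i^2)] reduce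
    this expectation to products over the coordinates. *)
Lemma integral_sum_gauss (R : realType) (n k : nat) (alpha : R) d
    (T : measurableType d) (P : probability T R) (X : 'I_n -> {RV P >-> R}) :
  0 < alpha -> mutually_independent X ->
  (forall i, has_density (X i) (gamma_pdf alpha)) ->
  (\int[P]_w (rv_sum X w `^ k%:R * expR (rv_sum X w - rv_sumsq X w))%:E =
   (k`!%:R * ((-1) ^+ k * beta_coef alpha n k))%:E)%E.
Proof.
move=> a0 indX dX.
pose G j := @gauss_weight R j.
have G0 j x : 0 <= G j x := @gauss_weight_ge0 R j x.
have mG j : measurable_fun setT (G j) := @measurable_gauss_weight R j.
have mSX := measurable_rv_sum X; have mQX := measurable_rv_sumsq X.
have mGX (c : {ffun 'I_n -> 'I_k.+1}) :
    measurable_fun setT (fun w => \prod_(i < n) G (c i) (X i w)).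
  by apply: measurable_prod => i _; exact: measurableT_comp.
have GX0 (c : {ffun 'I_n -> 'I_k.+1}) w : 0 <= \prod_(i < n) G (c i) (X i w).
  exact: prodr_ge0.
transitivity (\int[P]_w (k`!%:R%:E * (\sum_(c : {ffun 'I_n -> 'I_k.+1} | (\sum_(i < n) c i)%N == k)
    (\prod_(i < n) G (c i) (X i w))%:E)))%E.
  apply: ge0_ae_eq_integral => //.
  - apply/measurable_EFinP; apply: measurable_funM.
      by apply: (measurableT_comp (measurable_powR _)).
    by apply: measurableT_comp => //; exact: measurable_funB.
  - apply: measurable_funeM.
    under eq_fun do rewrite big_mkcond/=.
    apply: emeasurable_sum => c; case: (_ == _) => //.
    exact/measurable_EFinP.
  - by move=> w _; rewrite lee_fin mulr_ge0 ?powR_ge0 ?expR_ge0.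
  - by move=> w _; rewrite mule_ge0 ?lee_fin// sume_ge0// => c _; rewrite lee_fin.
  have : {ae P, forall w i, 0 < X i w}.
    by apply: filter_forall => i; exact: (gamma_pdf_pos_ae a0 (dX i)).
  apply: filterS => w Xw _.
  have S0 : 0 <= rv_sum X w by apply: sumr_ge0 => i _; exact: ltW.
  rewrite powR_mulrn// sumEFin -EFinM; congr EFin.
  rewrite [in LHS]/rv_sum multinomial_formula -mulrA mulr_suml; congr (_ * _).
  apply: eq_bigr => c _; rewrite /G /gauss_weight [in RHS]big_split/=; congr (_ * _).
    by apply: eq_bigr => i _; rewrite ger0_norm// ltW.
  by rewrite -expR_sum /rv_sumsq sumrB.
have msum : measurable_fun setT (fun w =>
  \sum_(c : {ffun 'I_n -> 'I_k.+1} | (\sum_(i < n) c i)%N == k)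
    (\prod_(i < n) G (c i) (X i w))%:E)%E.
  under eq_fun do rewrite big_mkcond/=.
  by apply: emeasurable_sum => c; case: (_ == _) => //; exact/measurable_EFinP.
rewrite ge0_integralZl ?lee_fin//; last first.
  by move=> w _; rewrite sume_ge0// => c _; rewrite lee_fin.
rewrite [RHS]EFinM; congr (_ * _)%E.
under eq_integral do rewrite big_mkcond/=.
rewrite ge0_integral_sum//; last 2 first.
- by move=> c; case: (_ == _) => //; exact/measurable_EFinP.
- by move=> c w _; case: (_ == _) => //; rewrite lee_fin.
rewrite /beta_coef mulrA (mulrA ((-1) ^+ k)) -expr2 -exprM mulnC exprM sqrrN expr1n expr1n mul1r.
rewrite mulr_sumr -sumEFin [RHS]big_mkcond/=; apply: eq_bigr => c _.
case: ifP => _; last by rewrite integral0.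
rewrite (integral_prod_independent (g := fun i => G (c i))
  (e := fun i => (2 * Gamma alpha)^-1 * (Gamma ((alpha + (c i)%:R) / 2) / (c i)`!%:R)))//.
- by rewrite big_split/= prodr_const card_ord exprVn.
- by move=> i; rewrite (integral_gauss_weight (c i) a0 (dX i)).
Qed.

Lemma integral_rv_ratio_powR (R : realType) (n k : nat) (alpha : R) d
    (T : measurableType d) (P : probability T R) (X : 'I_n -> {RV P >-> R}) :
  (0 < n)%N -> 0 < alpha -> mutually_independent X ->
  (forall i, has_density (X i) (gamma_pdf alpha)) ->
  (\int[P]_w (rv_ratio X w `^ (alpha * n%:R + k%:R))%:E =
   (k`!%:R * (-1) ^+ k * (2 * Gamma (alpha * n%:R) *
     (beta_coef alpha n k / Gamma ((alpha * n%:R + k%:R) / 2))))%:E)%E.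
Proof.
move=> n0 a0 indX dX; set a := alpha * n%:R.
have a_gt0 : 0 < a by rewrite mulr_gt0 ?ltr0n.
have p0 : 0 < (a + k%:R) / 2 by rewrite divr_gt0// ltr_wpDr.
have Gp0 := Gamma_gt0 p0.
have mW := measurable_rv_ratio X.
pose g (z : R * R) := z.1 `^ k%:R * expR (z.1 - z.2).
have mg : measurable_fun setT g.
  apply: measurable_funM; first by apply: (measurableT_comp (measurable_powR _)).
  by apply: measurableT_comp => //; exact: measurable_funB.
have g0 z : 0 <= g z by rewrite mulr_ge0 ?powR_ge0 ?expR_ge0.
have := polar_decomposition n0 a0 indX dX mg g0.
rewrite [X in (_ * X)%E](integral_sum_gauss k a0 indX dX) -/a => H.
have {}H : ((Gamma a)%:E * (k`!%:R * ((-1) ^+ k * beta_coef alpha n k))%:E =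
    (Gamma ((a + k%:R) / 2) / 2)%:E * \int[P]_w (rv_ratio X w `^ (a + k%:R))%:E)%E.
  rewrite H -ge0_integralZl ?lee_fin ?divr_ge0 ?(ltW Gp0)//; last 2 first.
  - by apply/measurable_EFinP; apply: (measurableT_comp (measurable_powR _)).
  - by move=> w _; rewrite lee_fin powR_ge0.
  apply: ge0_ae_eq_integral => //.
  - exact: (measurable_integral_polar_kernel a mg g0 (measurable_rv_sum X) (measurable_rv_sumsq X)).
  - apply: measurable_funeM.
    by apply/measurable_EFinP; apply: (measurableT_comp (measurable_powR _)).
  - move=> w _; apply: integral_ge0 => u; rewrite /= in_itv/= andbT => u0.
    by rewrite lee_fin polar_kernel_ge0.
  - by move=> w _; rewrite -EFinM lee_fin mulr_ge0 ?powR_ge0 ?divr_ge0 ?(ltW Gp0).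
  apply: filterS (rv_sum_gt0_ae n0 a0 dX) => w [Sw Qw] _.
  set S := rv_sum X w in Sw *; set Q := rv_sumsq X w in Qw *.
  have m2 : (- 2 : R) != 0 by rewrite oppr_eq0 pnatr_eq0.
  have := integral_power_gamma p0 m2 Qw.
  rewrite normrN ger0_norm// => E.
  transitivity ((S `^ (a + k%:R))%:E *
      (Q `^ (- ((a + k%:R) / 2)) * Gamma ((a + k%:R) / 2) / 2)%:E)%E; last first.
    rewrite -!EFinM; congr EFin.
    rewrite /rv_ratio -/S -/Q powRM ?invr_ge0 ?sqrtr_ge0 ?(ltW Sw)//.
    have -> : (Num.sqrt Q)^-1 `^ (a + k%:R) = Q `^ (- ((a + k%:R) / 2)).
      rewrite -[(Num.sqrt Q)^-1]powR_inv1 ?sqrtr_ge0// -powR12_sqrt ?(ltW Qw)// -!powRrM.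
      by congr (_ `^ _); field.
    ring.
  rewrite -E -ge0_integralZl ?lee_fin ?powR_ge0//; last 2 first.
  - apply/measurable_EFinP; apply: measurable_funTS; apply: measurable_funM.
      exact: measurable_powR.
    apply: measurableT_comp => //; apply: measurableT_comp => //.
    by apply: measurable_funM => //; exact: measurable_powR.
  - by move=> u _; rewrite lee_fin mulr_ge0 ?powR_ge0 ?expR_ge0.
  apply: eq_integral => u; rewrite inE/= in_itv/= andbT => u0; rewrite -EFinM; congr EFin.
  rewrite /polar_kernel /g/=.
  have -> : S / u = S * u `^ (-1) by rewrite powR_inv1 ?ltW.
  have -> : Q / u ^+ 2 = Q * u `^ (- 2).
    by rewrite -powR_invn ?ltW.
  rewrite -[u^-1]powR_inv1 ?(ltW u0)//.
  rewrite !powRM ?powR_ge0 ?(ltW Sw)// -!powRrM.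
  rewrite expRD; set y := S * _.
  have E1 : expR (- y) * expR y = 1 by rewrite -expRD addNr expR0.
  have -> : S `^ (a + k%:R) = S `^ a * S `^ k%:R by rewrite powRD// (gt_eqF Sw) implybT.
  have -> : u `^ ((a + k%:R) / 2 * -2 - 1) = u `^ (-1) * u `^ (-1 * a) * u `^ (-1 * k%:R).
    rewrite -!powRD ?(gt_eqF u0) ?implybT//; congr (_ `^ _); by field.
  by rewrite -[RHS]mul1r -[X in _ = X * _]E1; ring.
have : (\int[P]_w (rv_ratio X w `^ (a + k%:R))%:E =
  ((Gamma ((a + k%:R) / 2) / 2)^-1)%:E *
    ((Gamma a)%:E * (k`!%:R * ((-1) ^+ k * beta_coef alpha n k))%:E))%E.
  by rewrite H muleA -EFinM mulVf ?mul1e// mulf_neq0 ?invr_eq0 ?(gt_eqF Gp0).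
move=> ->; rewrite -!EFinM; congr EFin.
by field; rewrite (lt0r_neq0 Gp0).
Qed.

(** * Term-by-term integration *)

(** Dominated convergence for the partial sums; the real number [J] expresses
    that the integral of the limit is finite. *)
Lemma integral_series_dominated (R : realType) d (T : measurableType d)
    (m : {measure set T -> \bar R}) (D : set T) (c : nat -> T -> R) (G f : T -> R)
    (I : nat -> R) :
  measurable D -> (forall k, measurable_fun D (c k)) -> measurable_fun D f ->
  m.-integrable D (EFin \o G) -> (forall x, D x -> 0 <= G x) ->
  {ae m, forall x, D x -> (forall N, \sum_(0 <= k < N) `|c k x| <= G x) /\
                          series (c ^~ x) @ \oo --> f x} ->
  (forall k, \int[m]_(x in D) (c k x)%:E = (I k)%:E)%E ->
  exists2 J : R, (\int[m]_(x in D) (f x)%:E = J%:E)%E & series I @ \oo --> J.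
Proof.
move=> mD mc mf iG G0 H cI.
have ic k : m.-integrable D (EFin \o c k).
  apply/integrableP; split; first exact/measurable_EFinP.
  apply: (@le_lt_trans _ _ (\int[m]_(x in D) (G x)%:E)%E); last first.
    by rewrite -ge0_fin_numE ?integral_ge0//; exact: integrable_fin_num.
  apply: ae_ge0_le_integral => //.
  - apply: measurableT_comp => //; exact/measurable_EFinP.
  - exact: (measurable_int m iG).
  - apply: filterS H => x Hx Dx; have [+ _] := Hx Dx; move=> /(_ k.+1).
    rewrite big_nat_recr//= lee_fin; apply: le_trans.
    by rewrite lerDr sumr_ge0.
pose f_ (N : nat) x := (series (c ^~ x) N)%:E.
have mf_ N : measurable_fun D (f_ N).
  by apply/measurable_EFinP; apply: measurable_sum => k.
have mfE : measurable_fun D (EFin \o f) by exact/measurable_EFinP.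
have f_f : {ae m, forall x, D x -> f_ ^~ x @ \oo --> (EFin \o f) x}.
  apply: filterS H => x Hx Dx; have [_ cf] := Hx Dx.
  by apply: cvg_EFin => //; exact: nearW.
have f_G : {ae m, forall x N, D x -> (`|f_ N x| <= (EFin \o G) x)%E}.
  apply: filterS H => x Hx N Dx; have [+ _] := Hx Dx; move=> /(_ N).
  by rewrite lee_fin; apply: le_trans; exact: ler_norm_sum.
have [intf _ cvgI] := dominated_convergence mD mf_ mfE f_f iG f_G.
have fin := integrable_fin_num mD intf.
exists (fine (\int[m]_(x in D) (f x)%:E)); first by rewrite fineK.
have -> : series I = fun N => fine (\int[m]_(x in D) (series (c ^~ x) N)%:E)%E.
  apply/funext => N; rewrite /series/=.
  under [X in fine X]eq_integral do rewrite -sumEFin.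
  rewrite (integral_sum mD ic).
  by under [X in fine X]eq_bigr do rewrite cI; rewrite sumEFin.
by apply: fine_cvg; rewrite fineK//; apply: cvgI.
Qed.

Lemma sum_exp_coeff_le_expR (R : realType) (x : R) (N : nat) : 0 <= x ->
  \sum_(0 <= k < N) exp_coeff x k <= expR x.
Proof.
move=> x0; apply: (@nondecreasing_cvgn_le _ (series (exp_coeff x))); last first.
  exact: is_cvg_series_exp_coeff.
by apply: nondecreasing_series => k _ _; exact: exp_coeff_ge0.
Qed.

Lemma integral_powR_tail (R : realType) (L p : R) : 0 < L -> 0 < p ->
  (\int[lebesgue_measure]_(u in `[L, +oo[) (u `^ (- p - 1))%:E =
   (L `^ (- p) / p)%:E)%E.
Proof.
move=> L0 p0.
have gt0 (u : R) : L <= u -> 0 < u by exact: lt_le_trans.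
have dF (u : R) : 0 < u -> is_derive u 1 (fun u => - p^-1 * u `^ (- p)) (u `^ (- p - 1)).
  move=> u0; have d := @is_derive1_powR R (- p) u u0; apply: is_derive_eq.
  change (- p^-1 * (- p * u `^ (- p - 1)) = u `^ (- p - 1)).
  by rewrite mulrA mulNr mulrN opprK mulVf ?(gt_eqF p0)// mul1r.
have cF (u : R) : 0 < u -> {for u, continuous (fun u => - p^-1 * u `^ (- p))}.
  by move=> u0; apply: cvgM; [exact: cvg_cst|apply: continuous_powR; rewrite in_itv/= u0].
rewrite (@ge0_continuous_FTC2y _ (fun u => u `^ (- p - 1)) (fun u => - p^-1 * u `^ (- p)) L 0).
- by rewrite sub0e -EFinN; congr EFin; rewrite mulNr opprK mulrC.
- by move=> u _; exact: powR_ge0.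
- apply: continuous_in_subspaceT => u; rewrite inE/= in_itv/= andbT => Lu.
  by apply: continuous_powR; rewrite in_itv/= gt0.
- rewrite -[X in _ --> X](mulr0 (- p^-1)); apply: cvgM; first exact: cvg_cst.
  apply/cvgrPdist_le => e e0; near=> u.
  have u0 : 0 < u by near: u; exact: nbhs_pinfty_gt.
  have eu : e^-1 `^ p^-1 <= u by near: u; exact: nbhs_pinfty_ge.
  rewrite sub0r normrN ger0_norm ?powR_ge0// powRN invf_ple ?posrE ?powR_gt0//.
  have -> : e^-1 = ((e^-1) `^ (p^-1)) `^ p.
    by rewrite -powRrM mulVf ?(gt_eqF p0)// powRr1// invr_ge0 ltW.
  by apply: ge0_ler_powR; rewrite ?nnegrE ?powR_ge0 ?(ltW u0) ?(ltW p0).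
- by move=> u Lu; exact: (@ex_derive _ _ _ _ _ _ _ (dF _ (gt0 _ (ltW Lu)))).
- by apply: cvg_at_right_filter; exact: cF.
- move=> u; rewrite in_itv/= andbT => Lu; have := dF _ (gt0 _ (ltW Lu)) => d.
  by rewrite derive1E derive_val.
Unshelve. all: by end_near. Qed.

(** With [v = s / u] this is the lower incomplete gamma function at [s / L].
    Expand the exponential and integrate term by term; on [u >= L] the
    partial sums are dominated through [exp (s / u) <= exp (s / L)]. *)
Lemma incomplete_gamma_series (R : realType) (a s L : R) : 0 < a -> 0 < s -> 0 < L ->
  exists2 J : R,
    (\int[lebesgue_measure]_(u in `[L, +oo[)
       (u^-1 * (s / u) `^ a * expR (- (s / u)))%:E = J%:E)%E &
    series (fun k => (-1) ^+ k / k`!%:R * ((s / L) `^ (a + k%:R) / (a + k%:R))) @ \oo --> J.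
Proof.
move=> a0 s0 L0.
have ak0 (k : nat) : 0 < a + k%:R by rewrite ltr_wpDr.
have gt0 u : `[L, +oo[%classic u -> 0 < u.
  by rewrite /= in_itv/= andbT; exact: lt_le_trans.
have mD : measurable (`[L, +oo[%classic : set R) by exact: measurable_itv.
pose c (k : nat) u := (-1) ^+ k / k`!%:R * (s `^ (a + k%:R) * u `^ (- (a + k%:R) - 1)).
pose G u := s `^ a * u `^ (- a - 1) * expR (s / L).
have G0 u : 0 <= G u by rewrite mulr_ge0 ?expR_ge0// mulr_ge0 ?powR_ge0.
have mG : measurable_fun setT G.
  by apply: measurable_funM => //; apply: measurable_funM => //; exact: measurable_powR.
have tail p : 0 < p -> lebesgue_measure.-integrable `[L, +oo[ (fun u => (u `^ (- p - 1))%:E).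
  move=> p0; apply/integrableP; split.
    by apply/measurable_EFinP; apply: measurable_funTS; exact: measurable_powR.
  under eq_integral do rewrite /= ger0_norm ?powR_ge0//.
  by rewrite integral_powR_tail// ltry.
apply: (@integral_series_dominated _ _ _ lebesgue_measure _ c G) => //.
- move=> k; apply: measurable_funTS; apply: measurable_funM => //.
  by apply: measurable_funM => //; exact: measurable_powR.
- apply: measurable_funTS; apply: measurable_funM.
    apply: measurable_funM; first exact: measurable_invr.
    apply: (measurableT_comp (measurable_powR _)).
    by apply: measurable_funM => //; exact: measurable_invr.
  apply: measurableT_comp => //; apply: measurableT_comp => //.
  by apply: measurable_funM => //; exact: measurable_invr.
- have : lebesgue_measure.-integrable `[L, +oo[ (fun u =>
      (s `^ a * expR (s / L))%:E * (u `^ (- a - 1))%:E)%E.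
    by apply: integrableZl => //; exact: tail.
  by apply: eq_integrable => // u _; rewrite /= -EFinM /G mulrAC.
- apply: aeW => u Lu; have u0 := gt0 u Lu.
  have su0 : 0 <= s / u by rewrite divr_ge0 ?ltW.
  have sE k : s `^ (a + k%:R) * u `^ (- (a + k%:R) - 1) =
      s `^ a * u `^ (- a - 1) * (s / u) ^+ k.
    rewrite powRD ?(gt_eqF s0) ?implybT//.
    rewrite (_ : - (a + k%:R) - 1 = (- a - 1) + - k%:R); last by ring.
    rewrite [u `^ (_ + - k%:R)]powRD ?(gt_eqF u0) ?implybT//.
    by rewrite powR_invn ?ltW// powR_mulrn ?ltW// expr_div_n; ring.
  split.
    move=> N.
    rewrite (@le_trans _ _ (\sum_(0 <= k < N) (s `^ a * u `^ (- a - 1)) * exp_coeff (s / u) k))//.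
      apply: ler_sum => k _; rewrite /c sE normrM [X in _ * X]ger0_norm; last first.
        by rewrite mulr_ge0 ?exprn_ge0// mulr_ge0 ?powR_ge0.
      rewrite normrM normrX normrN1 expr1n mul1r ger0_norm ?invr_ge0//.
      by rewrite /exp_coeff/= le_eqVlt; apply/orP; left; apply/eqP; ring.
    rewrite -mulr_sumr ler_wpM2l ?mulr_ge0 ?powR_ge0//.
    apply: (le_trans (sum_exp_coeff_le_expR _ su0)).
    rewrite ler_expR ler_wpM2l ?(ltW s0)// lef_pV2 ?posrE//.
    by move: Lu; rewrite /= in_itv/= andbT.
  have -> : series (c ^~ u) = (s `^ a * u `^ (- a - 1)) *: series (exp_coeff (- (s / u))).
    rewrite -seriesZ; congr series; apply/funext => k.
    rewrite /c sE /exp_coeff fctE/= [(- (s / u)) ^+ k]exprNn.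
    change GRing.scale with (@GRing.mul R).
    ring.
  have -> : u^-1 * (s / u) `^ a = s `^ a * u `^ (- a - 1).
    rewrite powRM ?invr_ge0 ?(ltW u0) ?(ltW s0)// -!powR_inv1 ?(ltW u0)// -powRrM.
    rewrite mulrCA -powRD ?(gt_eqF u0) ?implybT//; congr (_ * _ `^ _); ring.
  by apply: cvgZr; exact: is_cvg_series_exp_coeff.
- move=> k; under eq_integral do rewrite /c mulrA EFinM.
  rewrite integralZl//; last exact: tail.
  rewrite integral_powR_tail// -EFinM powRM ?invr_ge0 ?(ltW s0) ?(ltW L0)//.
  rewrite -[L^-1]powR_inv1 ?(ltW L0)// -powRrM mulN1r; congr EFin; ring.
Qed.

(** * The radial distribution function *)

(** For the indicator [g] of [q <= r^2] the polar kernel is cut off at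
    [u = sqrt Q / r], so the inner integral is an incomplete gamma function of
    [r W]. Its series is dominated by a constant since [0 < W <= sqrt n]
    almost surely, and may be integrated term by term. *)
Lemma radial_cdf_power_series (R : realType) (n : nat) (alpha r : R) d
    (T : measurableType d) (P : probability T R) (X : 'I_n -> {RV P >-> R})
    (M : nat -> R) :
  (0 < n)%N -> 0 < alpha -> 0 < r -> mutually_independent X ->
  (forall i, has_density (X i) (gamma_pdf alpha)) ->
  (forall k, \int[P]_w (rv_ratio X w `^ (alpha * n%:R + k%:R))%:E = (M k)%:E)%E ->
  exists2 H : R, radial_cdf X r = H%:E &
    series (fun k => (-1) ^+ k / k`!%:R *
      (r `^ (alpha * n%:R + k%:R) / (alpha * n%:R + k%:R)) * M k) @ \oo -->
    Gamma (alpha * n%:R) * H.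
Proof.
move=> n0 a0 r0 indX dX; set a := alpha * n%:R => ME.
have a_gt0 : 0 < a by rewrite mulr_gt0 ?ltr0n.
have ak0 (k : nat) : 0 < a + k%:R by rewrite ltr_wpDr.
pose B := [set z : R * R | z.2 <= r ^+ 2].
have mB : measurable B.
  rewrite (_ : B = ~` [set z | r ^+ 2 < z.2]).
    by apply: measurableC; exact: measurable_set_ltr.
  by apply/seteqP; split => z /=; rewrite /B/= leNgt => /negP.
pose g : R * R -> R := \1_B.
have mg : measurable_fun setT g by exact: measurable_indic.
have g0 z : 0 <= g z by [].
have mSQ : measurable_fun setT (fun w => (rv_sum X w, rv_sumsq X w)).
  by apply: measurable_fun_pair; [exact: measurable_rv_sum|exact: measurable_rv_sumsq].
have cdfE : (\int[P]_w (g (rv_sum X w, rv_sumsq X w))%:E = radial_cdf X r)%E.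
  by rewrite (integral_indic_comp P mSQ mB).
have finH : radial_cdf X r \is a fin_num.
  rewrite -cdfE (integral_indic_comp P mSQ mB); apply: fin_num_measure.
  exact: measurable_preimageT.
exists (fine (radial_cdf X r)); first by rewrite fineK.
pose J w := (\int[lebesgue_measure]_(u in `]0%R, +oo[)
  (polar_kernel a g (rv_sum X w) (rv_sumsq X w) u)%:E)%E.
have mJ : measurable_fun setT J.
  exact: (measurable_integral_polar_kernel a mg g0 (measurable_rv_sum X) (measurable_rv_sumsq X)).
have J0 w : (0 <= J w)%E.
  apply: integral_ge0 => u; rewrite /= in_itv/= andbT => u0.
  by rewrite lee_fin polar_kernel_ge0.
pose c k w := (-1) ^+ k / k`!%:R * (r `^ (a + k%:R) / (a + k%:R)) * rv_ratio X w `^ (a + k%:R).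
have mW k : measurable_fun setT (fun w => rv_ratio X w `^ (a + k%:R)).
  by apply: (measurableT_comp (measurable_powR _)); exact: measurable_rv_ratio.
have inner w : 0 < rv_sum X w -> 0 < rv_sumsq X w ->
    exists2 j : R, J w = j%:E & series (c ^~ w) @ \oo --> j.
  move=> S0 Q0; set S := rv_sum X w in S0 *; set Q := rv_sumsq X w in Q0 *.
  have sQ0 : 0 < Num.sqrt Q by rewrite sqrtr_gt0.
  have L0 : 0 < Num.sqrt Q / r by rewrite divr_gt0.
  have [j jE jcvg] := incomplete_gamma_series a_gt0 S0 L0; exists j.
    rewrite -jE /J [LHS]integral_mkindic [RHS]integral_mkindic.
    apply: eq_integral => u _; congr EFin; rewrite indic_itv0y -/S -/Q /polar_kernel.
    have [u0|u0] := ltP 0 u; last first.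
      by rewrite mul0r indicE memNset ?mul0r//= in_itv/= andbT;
        apply/negP; rewrite -ltNge (le_lt_trans u0).
    rewrite mul1r mulrC; congr (_ * _); rewrite /g !indicE; congr (_%:R); congr nat_of_bool.
    (* the cut-off: [Q / u^2 <= r^2] means [u >= sqrt Q / r] *)
    have E : (Q / u ^+ 2 <= r ^+ 2) = (Num.sqrt Q / r <= u).
      rewrite ler_pdivrMr ?exprn_gt0// ler_pdivrMr// -exprMn [u * r]mulrC.
      by rewrite -{1}(sqr_sqrtr (ltW Q0)) ler_sqr ?nnegrE ?sqrtr_ge0// mulr_ge0 ?ltW.
    by apply/idP/idP; rewrite !inE /B/= in_itv/= andbT E.
  rewrite (_ : c ^~ w = (fun k =>
    (-1) ^+ k / k`!%:R * ((S / (Num.sqrt Q / r)) `^ (a + k%:R) / (a + k%:R))))//.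
  apply/funext => k; rewrite /c /rv_ratio -/S -/Q.
  rewrite (_ : S / (Num.sqrt Q / r) = r * (S / Num.sqrt Q)); last first.
    by rewrite invf_div mulrCA.
  by rewrite [(r * _) `^ _]powRM ?ltW// ?divr_gt0//; ring.
pose s := Num.sqrt n%:R : R.
have s0 : 0 <= s by exact: sqrtr_ge0.
pose C := (r * s) `^ a / a * expR (r * s).
have C0 : 0 <= C by rewrite mulr_ge0 ?expR_ge0// divr_ge0 ?powR_ge0 ?ltW.
have bound w : 0 < rv_sum X w -> 0 < rv_sumsq X w ->
    forall N, \sum_(0 <= k < N) `|c k w| <= C.
  move=> S0 Q0 N.
  have W0 : 0 < rv_ratio X w by rewrite divr_gt0// sqrtr_gt0.
  have Ws : rv_ratio X w <= s.
    by rewrite (le_trans (ler_norm _))// normr_rv_ratio_le.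
  have rs0 : 0 < r * s by rewrite mulr_gt0// (lt_le_trans W0).
  apply: (@le_trans _ _ (\sum_(0 <= k < N) ((r * s) `^ a / a) * exp_coeff (r * s) k)).
    apply: ler_sum => k _; rewrite /c !normrM normrX normrN1 expr1n mul1r.
    rewrite !ger0_norm ?powR_ge0 ?invr_ge0 ?(ltW (ak0 k))//.
    rewrite /exp_coeff/=.
    have -> : (r * s) `^ a / a * ((r * s) ^+ k / k`!%:R) =
        k`!%:R^-1 * ((r * s) `^ (a + k%:R) / a).
      by rewrite powRD ?(gt_eqF rs0) ?implybT// powR_mulrn ?(ltW rs0)//; ring.
    rewrite -mulrA ler_wpM2l ?invr_ge0//.
    rewrite mulrAC -powRM ?(ltW r0) ?(ltW W0)//.
    rewrite ler_pM ?powR_ge0 ?invr_ge0 ?(ltW (ak0 k))//.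
      apply: ge0_ler_powR;
        rewrite ?nnegrE ?(ltW (ak0 k)) ?(mulr_ge0 (ltW r0) (ltW W0)) ?(ltW rs0)//.
      by rewrite ler_wpM2l// (ltW r0).
    by rewrite lef_pV2 ?posrE// lerDl.
  rewrite -mulr_sumr ler_wpM2l ?divr_ge0 ?powR_ge0 ?(ltW a_gt0)//.
  by apply: sum_exp_coeff_le_expR; exact: ltW.
have := @integral_series_dominated R _ T P setT c (cst C) (fine \o J)
  (fun k => (-1) ^+ k / k`!%:R * (r `^ (a + k%:R) / (a + k%:R)) * M k).
case=> //.
- by move=> k; apply: measurable_funM.
- by apply: measurableT_comp => //; exact: fine_measurable.
- exact: finite_measure_integrable_cst.
- apply: filterS (rv_sum_gt0_ae n0 a0 dX) => w [S0 Q0] _; split; first exact: bound.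
  by have [j /= -> jcvg] := inner w S0 Q0.
- move=> k; under eq_integral do rewrite /c EFinM.
  rewrite integralZl//; first by rewrite ME.
  apply/integrableP; split; first exact/measurable_EFinP.
  by under eq_integral do rewrite /= ger0_norm ?powR_ge0//; rewrite ME ltry.
move=> j jE; suff -> : j = Gamma a * fine (radial_cdf X r) by [].
apply: EFin_inj; rewrite -jE EFinM (fineK finH) -cdfE (polar_decomposition n0 a0 indX dX mg g0).
apply: ge0_ae_eq_integral => //.
- by apply/measurable_EFinP; apply: measurableT_comp => //; exact: fine_measurable.
- by move=> w _; rewrite lee_fin fine_ge0.
- by move=> w _; exact: J0.
apply: filterS (rv_sum_gt0_ae n0 a0 dX) => w [S0 Q0] _.
by rewrite /= fineK// -/(J w); have [j' -> _] := inner w S0 Q0.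
Qed.

Theorem mainTheorem5 (R : realType) (n : nat) (hn : (2 <= n)%N)
    (alpha : R) (halpha : 0 < alpha)
    (d : measure_display) (T : measurableType d) (P : probability T R)
    (X : 'I_n -> {RV P >-> R})
    (hindep : mutually_independent X)
    (hdens : forall i : 'I_n, has_density (X i) (gamma_pdf alpha)) :
  (forall r : R, 0 < r ->
    let a := fun k : nat =>
      beta_coef alpha n k / Gamma (1 + (alpha * n%:R + k%:R) / 2) * r ^+ k in
    let b := fun k : nat =>
      mu_moment alpha X k / (alpha * n%:R + k%:R) * ((- r) ^+ k / (k`!)%:R) in
    [/\ cvgn (series a),
        radial_cdf X r = (r `^ (alpha * n%:R) * limn (series a))%:E,
        cvgn (series b) &
        radial_cdf X r =
          (r `^ (alpha * n%:R) / Gamma (alpha * n%:R) * limn (series b))%:E])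
  /\
  (forall k : nat,
    (-1) ^+ k / (k`!)%:R * mu_moment alpha X k =
    2 * Gamma (alpha * n%:R) *
      (beta_coef alpha n k / Gamma ((alpha * n%:R + k%:R) / 2))).
Proof.
have n0 : (0 < n)%N by exact: ltnW.
set m := alpha * n%:R; have m0 : 0 < m by rewrite mulr_gt0 ?ltr0n.
have mk0 (k : nat) : 0 < m + k%:R by rewrite ltr_wpDr.
have G0 := Gamma_gt0 m0.
have muE k : mu_moment alpha X k = fine (\int[P]_w (rv_ratio X w `^ (m + k%:R))%:E)%E.
  rewrite /mu_moment unlock; congr fine; apply: eq_integral => w _.
  by rewrite sqrt_cos_Phi.
have MI := fun k => integral_rv_ratio_powR k n0 halpha hindep hdens.
have ratioE k : (\int[P]_w (rv_ratio X w `^ (m + k%:R))%:E = (mu_moment alpha X k)%:E)%E.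
  by rewrite muE /m MI.
(* the identity between [mu_k] and [beta_k]; the square of the sign is [1] *)
have third k : (-1) ^+ k / (k`!)%:R * mu_moment alpha X k =
    2 * Gamma m * (beta_coef alpha n k / Gamma ((m + k%:R) / 2)).
  have k0 : k`!%:R != 0 :> R by rewrite pnatr_eq0 -lt0n fact_gt0.
  rewrite muE /m MI /= -/m; move: (2 * _ * _) => Y.
  by rewrite -[RHS]mul1r -[X in _ = X * _](sqrr_sign R k); field.
split=> // r r0 a b.
have [H HE cvgH] := radial_cdf_power_series n0 halpha r0 hindep hdens ratioE.
have rm0 : r `^ m != 0 by rewrite gt_eqF ?powR_gt0.
have cvgb : series b @ \oo --> (r `^ m)^-1 * (Gamma m * H).
  rewrite (_ : b = (r `^ m)^-1 *: (fun k => (-1) ^+ k / k`!%:R *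
      (r `^ (m + k%:R) / (m + k%:R)) * mu_moment alpha X k)).
    by rewrite seriesZ; exact: cvgZr.
  apply/funext => k; rewrite /b fctE; change GRing.scale with (@GRing.mul R).
  rewrite [(- r) ^+ k]exprNn powRD ?(gt_eqF r0) ?implybT// powR_mulrn ?(ltW r0)//.
  by field; rewrite rm0 pnatr_eq0 -lt0n fact_gt0 (lt0r_neq0 (mk0 k)).
(* the [beta]-series is termwise the [mu]-series, by the recursion for [Gamma] *)
have aE : a = (Gamma m)^-1 *: b.
  apply/funext => k; rewrite /a /b fctE; change GRing.scale with (@GRing.mul R).
  have p0 : 0 < (m + k%:R) / 2 by rewrite divr_gt0.
  rewrite [1 + _]addrC GammaS// [(- r) ^+ k]exprNn.
  transitivity ((Gamma m)^-1 * ((-1) ^+ k / (k`!)%:R * mu_moment alpha X k) /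
    (m + k%:R) * r ^+ k); last by ring.
  by rewrite third; field; rewrite !gt_eqF ?Gamma_gt0.
have cvga : series a @ \oo --> (Gamma m)^-1 * ((r `^ m)^-1 * (Gamma m * H)).
  by rewrite aE seriesZ; exact: cvgZr.
split.
- by apply: cvgP cvga.
- by rewrite (cvg_lim _ cvga)// HE; congr EFin; field; rewrite rm0 gt_eqF.
- by apply: cvgP cvgb.
- by rewrite (cvg_lim _ cvgb)// HE; congr EFin; field; rewrite rm0 gt_eqF.
Qed.
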